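(* Let $1\le n<d$, $\gamma>0$, let $\Sigma_0$ be a symmetric positive semidefinite $d\times d$ matrix with eigenvalues $\lambda_1^0\ge\cdots\ge\lambda_d^0\ge0$, and let $(\lambda_1(t),\dots,\lambda_d(t))$ be the global solution of $$\frac{\mathrm d}{\mathrm dt}\lambda_i(t)=-4c_n\lambda_i(t)e_{n-1}(\hat\lambda_i(t))+2\gamma,\qquad\lambda_i(0)=\lambda_i^0,\quad1\le i\le d$$ (the eigenvalues of the covariance solution $\Sigma_t$). Define $$\lambda_\ast:=\left(\frac{\gamma n!}{2(n+1)\binom{d-1}{n-1}}\right)^{1/n},\quad \alpha_\perp:=4c_n\binom{d-2}{n-1}\lambda_\ast^{n-1},\quad\alpha_\parallel:=4c_nn\binom{d-1}{n-1}\lambda_\ast^{n-1}=\frac{2n\gamma}{\lambda_\ast}.$$ Then: (1) If $\lambda_i^0\ne\lambda_j^0$ for some distinct $i,j$, then $$|\lambda_i(t)-\lambda_j(t)|\asymp e^{-\alpha_\perp t},\qquad\lim_{t\to\infty}\frac1t\log|\lambda_i(t)-\lambda_j(t)|=-\alpha_\perp.$$ (2) If $\Sigma_0$ is not a scalar multiple of $I_d$, then $$\max_{1\le i\le d}|\lambda_i(t)-\lambda_\ast|\asymp e^{-\alpha_\perp t},\qquad\text{and therefore}\qquad\lim_{t\to\infty}\frac1t\log\max_{1\le i\le d}|\lambda_i(t)-\lambda_\ast|=-\alpha_\perp.$$ (3) If $\Sigma_0=s_0I_d$ for some $s_0\ge0$ with $s_0\ne\lambda_\ast$, then $\lambda_i(t)=s(t)$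 for every $i$ (for a scalar function $s$) and $$\max_{1\le i\le d}|\lambda_i(t)-\lambda_\ast|=|s(t)-\lambda_\ast|\asymp e^{-\alpha_\parallel t}.$$ If $\Sigma_0=\lambda_\ast I_d$, then $\Sigma_t=\Sigma_0$ for all $t\ge0$. In particular, $\alpha_\parallel\ge\alpha_\perp$, with equality when $n=1$.
   Context: $c_n:=\frac{n+1}{n!}$. $e_k$ is the $k$-th elementary symmetric polynomial ($e_0=1$), and $e_{n-1}(\hat\lambda_i)$ is $e_{n-1}$ of the list $\lambda_1,\dots,\lambda_d$ with $\lambda_i$ omitted. $\Sigma_t$ denotes the unique global solution of $\frac{\mathrm d}{\mathrm dt}\Sigma_t=-4c_n\Sigma_tT_{n-1}(\Sigma_t)+2\gamma I_d$ with initial value $\Sigma_0$, where $T_k(A)=\sum_{\ell=0}^k(-1)^\ell e_{k-\ell}(A)A^\ell$ and $e_k(A)$ is $e_k$ of the eigenvalues of $A$; if $\Sigma_0=P^\top\operatorname{diag}(\lambda_i^0)P$ with $P$ orthogonal then $\Sigma_t=P^\top\operatorname{diag}(\lambda_i(t))P$. $f(t)\asymp g(t)$ (as $t\to\infty$) means there are $c,C,t_0>0$ with $cg(t)\le f(t)\le Cg(t)$ for all $t\ge t_0$. *)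

(* Defs.v *)
From HB Require Import structures.
From mathcomp Require Import all_boot all_order all_algebra.
From mathcomp Require Import all_classical all_reals all_analysis.
From mathcomp Require Import complex.
From mathcomp Require mpoly.

Set Implicit Arguments.
Unset Strict Implicit.
Unset Printing Implicit Defensive.
Import Order.TTheory GRing.Theory Num.Theory.
Import numFieldNormedType.Exports.
Local Open Scope classical_set_scope.
Local Open Scope complex_scope.
Local Open Scope ring_scope.

Definition elemsym (K : comNzRingType) (m k : nat) (x : 'I_m -> K) : K :=
  mpoly.meval x (mpoly.mesym m K k).

(* [omit i x] is the list x_1, ..., x_d without x_i. *)
Definition omit (T : Type) (d : nat) (i : 'I_d) (x : 'I_d -> T) : 'I_d.-1 -> T :=
  fun j => x (lift i j).

(* The eigenvalues with multiplicity, in some order, in the algebraic closure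
   R[i] of R, so that they exist for every real matrix. *)
Definition eigenvals (R : realType) (d : nat) (A : 'M[R]_d) :
    'I_d -> R[i] :=
  xget (fun=> 0) [set x : 'I_d -> R[i] |
    map_poly (real_complex R) (char_poly A) =
      \prod_(i < d) ('X - (x i)%:P)].

(* Non-real eigenvalues come in conjugate pairs, so e_k of the eigenvalues is
   real and [Re] only casts it to R. *)
Definition elemsym_mx (R : realType) (d k : nat) (A : 'M[R]_d) : R :=
  complex.Re (elemsym k (eigenvals A)).

Definition Tmx (R : realType) (d k : nat) (A : 'M[R]_d) : 'M[R]_d :=
  \sum_(l < k.+1) ((-1) ^+ l * elemsym_mx (k - l) A) *: A ^+ l.

Definition cn (R : realType) (n : nat) : R := n.+1%:R / (n`!)%:R.

(* Derivative of a function on [0, +oo[: one-sided at t = 0, two-sided at t > 0.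
   Only the values of f on [0, +oo[ matter. *)
Definition has_deriv_ge0 (R : realType) (f : R -> R) (t l : R) : Prop :=
  (f s - f t) / (s - t) @[s --> within `[0, +oo[ t^'] --> l.

Definition eigen_flow (R : realType) (d n : nat) (gamma : R)
    (lam0 : 'I_d -> R) (lam : R -> 'I_d -> R) : Prop :=
  lam 0 = lam0 /\
  forall t : R, 0 <= t -> forall i,
    has_deriv_ge0 (fun s => lam s i) t
      (- 4 * cn R n * lam t i * elemsym n.-1 (omit i (lam t)) + 2 * gamma).

Definition cov_flow (R : realType) (d n : nat) (gamma : R)
    (Sigma0 : 'M[R]_d) (Sigma : R -> 'M[R]_d) : Prop :=
  Sigma 0 = Sigma0 /\
  forall t : R, 0 <= t -> forall i j,
    has_deriv_ge0 (fun s => Sigma s i j) t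
      ((- (4 * cn R n) *: (Sigma t *m Tmx n.-1 (Sigma t)) + (2 * gamma)%:M) i j).

Definition symmetric_psd (R : realType) (d : nat) (A : 'M[R]_d) : Prop :=
  A^T = A /\ forall v : 'cV[R]_d, 0 <= (v^T *m A *m v) 0 0.

Definition asymp_equiv (R : realType) (f g : R -> R) : Prop :=
  exists c C t0 : R, [/\ 0 < c, 0 < C, 0 < t0 &
    forall t, t0 <= t -> c * g t <= f t /\ f t <= C * g t].

Definition lam_star (R : realType) (d n : nat) (gamma : R) : R :=
  (gamma * (n`!)%:R / (2 * n.+1%:R * 'C(d - 1, n - 1)%:R)) `^ (n%:R^-1).

Definition alpha_perp (R : realType) (d n : nat) (gamma : R) : R :=
  4 * cn R n * 'C(d - 2, n - 1)%:R * lam_star d n gamma ^+ (n - 1).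

Definition alpha_par (R : realType) (d n : nat) (gamma : R) : R :=
  4 * cn R n * n%:R * 'C(d - 1, n - 1)%:R * lam_star d n gamma ^+ (n - 1).

(* The neutral element 0 is harmless: the terms are nonnegative. *)
Definition max_dev (R : realType) (d : nat) (a : R) (x : 'I_d -> R) : R :=
  \big[Num.max/0]_(i < d) `|x i - a|.

(* Main.v *)
Require Import Defs.
From HB Require Import structures.
From mathcomp Require Import all_boot all_order all_algebra.
From mathcomp Require Import all_classical all_reals all_analysis.
From mathcomp Require Import complex ring lra zify.
From mathcomp Require mpoly.

(** Write k = n - 1, c = 4 c_n.  Differences of eigenvalues satisfy the scalar
    linear equation g' = - c e_k(all but i, j) g, so the order of the eigenvalues
    is preserved and their spread does not increase.  The smallest eigenvalue m
    is bounded above since e_k of the others is at least C(d-1,k) m^k; hence all are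
    bounded, hence all are eventually bounded away from 0, and then the differences
    decay exponentially.  The deviation u = x_m - lam_star solves
    u' = - q u + r with q = c C(d-1,k) (x_m^n - lam_star^n) / (x_m - lam_star) and
    r controlled by the differences, so u decays exponentially too.  With this
    convergence every coefficient above is an exponentially small, hence
    integrable, perturbation of its limit (alpha_perp for differences, alpha_par
    for u), which yields the exact rates.  Since alpha_par > alpha_perp unless
    n = 1, the differences dominate u when the spectrum is not constant.  The
    matrix equation is polynomial in the entries, so solutions are unique and
    P^T diag(lam) P, which solves it, is the flow. *)

Set Implicit Arguments.
Unset Strict Implicit.
Unset Printing Implicit Defensive.
Import Order.TTheory GRing.Theory Num.Theory.
Import numFieldNormedType.Exports.
Import (canonicals, coercions) mpoly.
Local Open Scope classical_set_scope.
Local Open Scope ring_scope.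

(** * Differential inequalities on the half-line *)

Section HalfLine.
Variable R : realType.
Implicit Types (f g : R -> R) (a b t K : R).

(* Flows on [0, +oo[ are precomposed with max 0, which makes them continuous on
   the whole line and keeps them differentiable at positive times. *)
Definition deriv_pos f f' :=
  continuous f /\ forall t, 0 < t -> is_derive t 1 f (f' t).

Lemma deriv_pos_ext f f' g' :
  (forall t, 0 < t -> f' t = g' t) -> deriv_pos f f' -> deriv_pos f g'.
Proof. by move=> e [cf df]; split=> // t t0; rewrite -e//; exact: df. Qed.

Lemma deriv_pos_cst a : deriv_pos (fun=> a) (fun=> 0).
Proof. by split=> [t|t _]; [exact: cst_continuous | exact: is_derive_cst]. Qed.

Lemma deriv_posD f f' g g' : deriv_pos f f' -> deriv_pos g g' ->
  deriv_pos (fun t => f t + g t) (fun t => f' t + g' t).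
Proof.
move=> [cf df] [cg dg]; split=> [t|t t0]; first exact: cvgD (cf t) (cg t).
by have := df t t0; have := dg t t0 => ? ?; exact: is_deriveD.
Qed.

Lemma deriv_posN f f' : deriv_pos f f' ->
  deriv_pos (fun t => - f t) (fun t => - f' t).
Proof.
move=> [cf df]; split=> [t|t t0]; first exact: cvgN (cf t).
by have := df t t0 => ?; exact: is_deriveN.
Qed.

Lemma deriv_posB f f' g g' : deriv_pos f f' -> deriv_pos g g' ->
  deriv_pos (fun t => f t - g t) (fun t => f' t - g' t).
Proof. by move=> df /deriv_posN; exact: deriv_posD. Qed.

Lemma deriv_posM f f' g g' : deriv_pos f f' -> deriv_pos g g' ->
  deriv_pos (fun t => f t * g t) (fun t => f t * g' t + g t * f' t).
Proof.
move=> [cf df] [cg dg]; split=> [t|t t0]; first exact: cvgM (cf t) (cg t).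
by have := df t t0; have := dg t t0 => ? ?; exact: is_deriveM.
Qed.

Lemma deriv_posZ a f f' : deriv_pos f f' ->
  deriv_pos (fun t => a * f t) (fun t => a * f' t).
Proof.
move=> /(deriv_posM (deriv_pos_cst a)); apply: deriv_pos_ext => t _.
by rewrite mulr0 addr0.
Qed.

Lemma deriv_pos_sum (I : Type) (r : seq I) (P : pred I) (F F' : I -> R -> R) :
  (forall i, deriv_pos (F i) (F' i)) ->
  deriv_pos (fun t => \sum_(i <- r | P i) F i t)
            (fun t => \sum_(i <- r | P i) F' i t).
Proof.
move=> dF; elim: r => [|i r IH].
  rewrite (_ : (fun t => _) = fun=> 0); last by apply/funext => t; rewrite big_nil.
  by apply: deriv_pos_ext (deriv_pos_cst 0) => t _; rewrite big_nil.
rewrite (_ : (fun t => _) =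
  fun t => (if P i then F i t else 0) + \sum_(j <- r | P j) F j t).
  apply: (@deriv_pos_ext _ (fun t => (if P i then F' i t else 0) +
    \sum_(j <- r | P j) F' j t)) => [t _|].
    by rewrite big_cons; case: (P i) => //; rewrite add0r.
  apply: deriv_posD => //; case: (P i); [exact: dF|exact: deriv_pos_cst].
by apply/funext => t; rewrite big_cons; case: (P i) => //; rewrite add0r.
Qed.

Lemma deriv_pos_expR f f' : deriv_pos f f' ->
  deriv_pos (fun t => expR (f t)) (fun t => f' t * expR (f t)).
Proof.
move=> [cf df]; split=> [t|t t0].
  by apply: continuous_comp; [exact: cf|exact: continuous_expR].
by have := df t t0 => ?; apply: is_derive_eq; rewrite mulrC.
Qed.

Lemma deriv_pos_expRM a :
  deriv_pos (fun t => expR (a * t)) (fun t => a * expR (a * t)).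
Proof.
apply: deriv_pos_expR; split=> [t|t _].
  by apply: cvgM; [exact: cvg_cst|exact: cvg_id].
by have := is_deriveZ (f := id) a (is_derive_id t (1:R)); rewrite scaler1.
Qed.

Lemma deriv_pos_bounded f f' b : deriv_pos f f' ->
  exists K, forall t, 0 <= t <= b -> `|f t| <= K.
Proof.
move=> [cf _]; have [b0|b0] := leP 0 b; last first.
  by exists 0 => t /andP[t0 tb]; have := lt_le_trans b0 (le_trans t0 tb); rewrite ltxx.
have : {within `[0, b], continuous (fun t => `|f t|)}.
  by apply: continuous_subspaceT => t; apply: cvg_norm; exact: cf.
by move=> /(EVT_max b0)[c _ hc]; exists `|f c| => t ht; apply: hc; rewrite in_itv.
Qed.

(* Comparison principle: while f is negative, f * e^(-Kt) does not decrease, so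
   f cannot have left the nonnegative half-line. *)
Lemma deriv_pos_ge0 f f' K a b : deriv_pos f f' -> 0 <= a -> a <= b ->
  0 <= f a -> (forall t, a < t -> t < b -> f t < 0 -> K * f t <= f' t) ->
  0 <= f b.
Proof.
move=> df a0 ab fa hf; rewrite leNgt; apply/negP => fb.
(* The supremum of S is the last time up to b at which f is nonnegative; continuity puts it in S. *)
pose S := [set s : R | a <= s <= b /\ 0 <= f s].
have Sa : S a by split; rewrite ?lexx.
have Sub : ubound S b by move=> s [/andP[]].
have hS : has_sup S by split; [exists a|exists b].
have leS := sup_upper_bound hS.
have [cf _] := df.
set c := sup S.
have ac : a <= c by exact: leS.
have cb : c <= b by apply: ge_sup => //; exists a.
have fc : 0 <= f c.
  rewrite leNgt; apply/negP => fc.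
  have : \forall s \near c, f s < 0 by exact: (cvgr_lt _ (cf c)).
  move=> [/= e e0 he].
  have [s Ss cs] := sup_adherent e0 hS.
  have sc : s <= c by exact: leS.
  have := he s; case: Ss => _ /[swap] /(_ _)/lt_geF => /(_ _) -> //.
  by rewrite /ball /= ger0_norm ?subr_ge0// ltrBlDr addrC -ltrBlDr.
have fn s : c < s -> s <= b -> f s < 0.
  move=> cs sb; rewrite ltNge; apply/negP => fs.
  have : s <= c by apply: leS; split=> //; rewrite sb (le_trans ac (ltW cs)).
  by rewrite leNgt cs.
have dh := deriv_posM df (deriv_pos_expRM (- K)).
have [ch dh'] := dh.
have : f c * expR (- K * c) <= f b * expR (- K * b).
  apply: (@ger0_derive1_le_cc _ (fun t => f t * expR (- K * t)) c b) => //.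
  - move=> t; rewrite in_itv/= => /andP[ct tb].
    by have := dh' t (le_lt_trans a0 (le_lt_trans ac ct)) => ?.
  - move=> t; rewrite in_itv/= => /andP[ct tb]; rewrite derive1E.
    have := dh' t (le_lt_trans a0 (le_lt_trans ac ct)) => d.
    rewrite derive_val.
    rewrite [leRHS](_ : _ = (f' t - K * f t) * expR (- K * t)); last by ring.
    rewrite mulr_ge0 ?expR_ge0// subr_ge0.
    exact: hf (le_lt_trans ac ct) tb (fn t ct (ltW tb)).
  - exact: continuous_subspaceT.
  - by rewrite in_itv/= lexx.
  - by rewrite in_itv/= lexx andbT.
apply/negP; rewrite -ltNge; apply: (@lt_le_trans _ _ 0).
  by rewrite pmulr_llt0 ?expR_gt0.
by rewrite mulr_ge0 ?expR_ge0.
Qed.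

(** Multiplying the difference quotient by s - t shows that f is continuous relative to [0, +oo[,
    and [max 0] extends this to the line. Near a positive time [max 0] is the identity, so the
    derivative within the half-line is the ordinary one. *)
Lemma has_deriv_ge0_deriv_pos f l :
  (forall t, 0 <= t -> has_deriv_ge0 f t (l t)) ->
  deriv_pos (fun t => f (Num.max 0 t)) l.
Proof.
move=> df; split=> [x|t t0].
  set t := Num.max 0 x.
  have t0 : 0 <= t by rewrite le_max lexx.
  have maxx : Num.max 0 s @[s --> x] --> t.
    by apply: continuous_max; [exact: cvg_cst|exact: cvg_id].
  have fs : f s - f t @[s --> within `[0, +oo[ t^'] --> 0.
    rewrite -[X in _ --> X](mulr0 (l t)) (_ : (fun s => _) =
      fun s => (f s - f t) / (s - t) * (s - t)); last first.
      apply/funext => s; have [->|st] := eqVneq s t; first by rewrite !subrr mulr0.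
      by rewrite divfK// subr_eq0.
    apply: cvgM; first exact: df.
    do 2 apply: cvg_within_filter.
    have : s - t @[s --> t] --> t - t by apply: cvgB; [exact: cvg_id|exact: cvg_cst].
    by rewrite subrr.
  apply/cvgrPdist_lt => e e0; move/cvgrPdist_lt: fs => /(_ e e0) hA.
  have {}hA : \forall s \near t, (s != t -> `[0, +oo[%classic s ->
    `|0 - (f s - f t)| < e) by exact: hA.
  have hB : \forall s \near t, (0 <= s -> `|f t - f s| < e).
    apply: filterS hA => s hs s0; have [->|st] := eqVneq s t.
      by rewrite subrr normr0.
    by have := hs st; rewrite /= in_itv/= andbT s0 sub0r opprB => /(_ isT).
  have hC : \forall s \near x, (0 <= Num.max 0 s -> `|f t - f (Num.max 0 s)| < e).
    exact: maxx hB.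
  suff : \forall s \near x, `|f t - f (Num.max 0 s)| < e by [].
  apply: filterS hC => s; apply.
  by rewrite le_max lexx.
suff h : h^-1 *: ((fun s => f (Num.max 0 s)) (h *: 1 + t) - f (Num.max 0 t))
    @[h --> 0^'] --> l t.
  by split; [apply/cvg_ex; exists (l t)|apply/cvg_lim].
have ht := df t (ltW t0); apply/cvgrPdist_lt => e e0.
move/cvgrPdist_lt: ht => /(_ e e0) hA.
have {}hA : \forall s \near t, (s != t -> `[0, +oo[%classic s ->
  `|l t - (f s - f t) / (s - t)| < e) by exact: hA.
have cvgh : h *: (1 : R) + t @[h --> 0] --> t.
  have : h *: (1 : R) + t @[h --> 0] --> 0 *: 1 + t.
    by apply: cvgD; [apply: cvgZl; exact: cvg_id|exact: cvg_cst].
  by rewrite scale0r add0r.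
have hB : \forall h \near (0 : R), (h *: (1 : R) + t != t ->
    `[0, +oo[%classic (h *: (1 : R) + t) ->
    `|l t - (f (h *: (1 : R) + t) - f t) / (h *: (1 : R) + t - t)| < e).
  exact: cvgh hA.
have hC : \forall h \near (0 : R), 0 < h *: (1 : R) + t.
  exact: (cvgr_gt _ cvgh).
suff : \forall h \near (0 : R), (h != 0 ->
    `|l t - h^-1 *: (f (Num.max 0 (h *: (1 : R) + t)) - f (Num.max 0 t))| < e).
  by [].
apply: filterS2 hC hB => h h0 hh hn.
rewrite (max_idPr (ltW h0)) (max_idPr (ltW t0)).
have := hh; rewrite -subr_eq0 addrK /GRing.scale /= mulr1 in_itv/= andbT in h0 *.
by move=> /(_ hn (ltW h0)); rewrite [_^-1 * _]mulrC.
Qed.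

End HalfLine.

(** * Elementary symmetric polynomials *)

Section ElementarySymmetric.
Variables (K : comNzRingType) (d : nat).
Implicit Types (x : 'I_d -> K) (A : {set 'I_d}).

(** A coefficient of the generating product. Indexing by a subset keeps one index type when one or
    two eigenvalues are left out. *)
Definition esym A k x := (\prod_(l in A) (1 + x l *: 'X))`_k.

Lemma elemsymE m k (x : 'I_m -> K) :
  elemsym k x = (\prod_(l < m) (1 + x l *: 'X))`_k.
Proof.
rewrite /elemsym /mpoly.mesym.
under [in RHS]eq_bigr => l _ do rewrite addrC.
rewrite bigA_distr /= coef_sum raddf_sum /= big_mkcond; apply: eq_bigr => J _.
rewrite -big_mkcond /=.
under [in RHS]eq_bigr => l _ do rewrite -mul_polyC.
rewrite big_split /= prodr_const -rmorph_prod coefCM coefXn eq_sym.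
case: eqP => _; last by rewrite mulr0.
by rewrite mulr1 rmorph_prod /=; apply: eq_bigr => l _; rewrite mpoly.mevalXU.
Qed.

Lemma elemsym_esym k x : elemsym k x = esym finset.setT k x.
Proof. by rewrite elemsymE /esym; under [in RHS]eq_bigl => l do rewrite inE. Qed.

Lemma elemsym_omit k x i : elemsym k (omit i x) = esym [set~ i]%SET k x.
Proof.
rewrite elemsymE /esym; congr (polyseq _)`_k.
rewrite [RHS](reindex_omap (lift i) (unlift i)) /=.
  by apply: eq_bigl => j; rewrite liftK !inE eq_sym neq_lift eqxx.
by move=> j; rewrite !inE; case: unliftP => [l ->|->] //; rewrite eqxx.
Qed.

Lemma esym0 A x : esym A 0 x = 1.
Proof.
rewrite /esym; elim/big_rec: _ => [|l p _ IH]; first by rewrite coef1.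
by rewrite coef0M IH coefD coef1 coefZ coefX mulr0 addr0 mulr1.
Qed.

Lemma esymS A k x i : i \in A ->
  esym A k.+1 x = esym (A :\ i) k.+1 x + x i * esym (A :\ i) k x.
Proof.
move=> iA; rewrite /esym (big_setD1 _ iA) /= mulrDl mul1r coefD.
by rewrite -scalerAl coefZ coefXM.
Qed.

Lemma esym_const A k (a : K) :
  esym A k (fun=> a) = 'C(#|A|, k)%:R * a ^+ k.
Proof.
rewrite /esym prodr_const exprDn coef_sum.
transitivity (\sum_(i < #|A|.+1) (if i == k :> nat then 'C(#|A|, k)%:R * a ^+ k else 0)).
  apply: eq_bigr => i _; rewrite expr1n mul1r coefMn exprZn coefZ coefXn eq_sym.
  by case: eqP => [->|_]; rewrite ?mulr1 ?mulr0 ?mul0rn// mulr_natl.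
rewrite -big_mkcond /=; have [kA|kA] := ltnP k #|A|.+1.
  by rewrite (big_pred1 (Ordinal kA)) // => i; rewrite -val_eqE.
rewrite big1 ?bin_small ?mul0r//.
Qed.

(** The powers of - x_i are the coefficients of 1 / (1 + x_i X), so the alternating sum divides the
    generating product by the factor of i. It is the i-th diagonal entry of [Tmx] at a diagonal
    matrix. *)
Lemma elemsym_cancel k x i :
  \sum_(l < k.+1) (-1) ^+ l * elemsym (k - l) x * x i ^+ l = elemsym k (omit i x).
Proof.
elim: k => [|k IH].
  by rewrite big_ord1 subnn elemsym_omit elemsym_esym !esym0 !mulr1.
rewrite big_ord_recl /= expr0 mul1r mulr1 subn0.
under eq_bigr => l _ do rewrite /bump /= add1n subSS !exprS.
rewrite elemsym_esym (@esymS _ _ _ i) ?inE// finset.setTD elemsym_omit.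
rewrite -[RHS]addr0 -addrA; congr (_ + _).
rewrite -elemsym_omit -IH mulr_sumr -big_split /= big1 // => l _.
by rewrite mulN1r; ring.
Qed.

(** Expanding each side in the other omitted variable, the terms in x_i x_j cancel. This is what
    makes the equation for an eigenvalue difference linear in that difference. *)
Lemma esym_diff k x i j : i != j ->
  x i * elemsym k (omit i x) - x j * elemsym k (omit j x) =
  (x i - x j) * esym (~: [set i; j]%SET) k x.
Proof.
move=> ij; rewrite !elemsym_omit.
have ji : j \in [set~ i]%SET by rewrite !inE eq_sym.
have jj : i \in [set~ j]%SET by rewrite !inE.
have -> : (~: [set i; j]%SET) = [set~ i]%SET :\ j 
  by apply/setP => l; rewrite !inE; do 2 case: eqP.
have e : [set~ i]%SET :\ j = [set~ j]%SET :\ i by apply/setP => l; rewrite !inE andbC.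
case: k => [|k]; first by rewrite !esym0 !mulr1.
by rewrite (esymS _ _ ji) (esymS _ _ jj) e; ring.
Qed.

End ElementarySymmetric.

Lemma coef_prod_XsubC_elemsym (K : idomainType) m k (x : 'I_m -> K) : (k <= m)%N ->
  elemsym k x = (-1) ^+ k * (\prod_(i < m) ('X - (x i)%:P))`_(m - k).
Proof.
move=> km; have := mpoly.mroots_coeff [tuple x i | i < m] (inord k).
rewrite inordK ?ltnS// big_tuple => h.
under eq_bigr => i _ do rewrite -[x i](tnth_mktuple x).
rewrite h mulrA -expr2 sqrr_sign mul1r /elemsym; congr mpoly.meval.
by apply/funext => i; rewrite tnth_mktuple.
Qed.

(** * Coefficientwise order of polynomials and monotonicity of e_k *)

Section CoefOrder.
Variable R : realType.

(** Nonnegativity is built in because multiplication preserves the order only between polynomials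
    with nonnegative coefficients. *)
Definition coef_le (p q : {poly R}) := forall k, 0 <= p`_k <= q`_k.

Lemma coef_leM p p' q q' : coef_le p q -> coef_le p' q' -> coef_le (p * p') (q * q').
Proof.
move=> h h' k; rewrite !coefM sumr_ge0 /=; last first.
  by move=> i _; have /andP[? _] := h i; have /andP[? _] := h' (k - i)%N; exact: mulr_ge0.
apply: ler_sum => i _.
by have /andP[? ?] := h i; have /andP[? ?] := h' (k - i)%N; exact: ler_pM.
Qed.

(** It serves twice: with x = y it gives nonnegativity, and with one side constant it compares e_k
    with a binomial multiple of a power. *)
Lemma esym_le d (A : {set 'I_d}) k (x y : 'I_d -> R) :
  (forall i, i \in A -> 0 <= x i <= y i) -> 0 <= esym A k x <= esym A k y.
Proof.
move=> xy; rewrite /esym; move: k.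
suff : coef_le (\prod_(l in A) (1 + x l *: 'X)) (\prod_(l in A) (1 + y l *: 'X)) by [].
elim/big_rec2: _ => [k|i p q iA IH]; first by rewrite coef1 ler0n lexx.
apply: coef_leM => // k; rewrite !coefD !coefZ !coefX coef1.
have /andP[x0 xyi] := xy i iA.
by case: k => [|[|k]] /=; rewrite ?mulr0 ?mulr1 ?addr0 ?add0r ?ler01 ?lexx ?x0 ?xyi.
Qed.

End CoefOrder.

(** * Quantitative closeness of functions, stable under polynomial operations *)

Section Close.
Variables (R : realType) (T : Type) (w : T -> R) (D : set T).
Hypothesis w_ge0 : forall t, D t -> 0 <= w t.
Implicit Types f g : T -> R.

(* A class stable under ring operations, used with w(t) = e^(-bt) for exponential
   convergence, with w a distance for local Lipschitz bounds, and with w = 0 for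
   boundedness. *)
Definition close f g := exists2 K, 0 <= K &
  forall t, D t -> [/\ `|f t| <= K, `|g t| <= K & `|f t - g t| <= K * w t].

Lemma close_ext f f' g g' : (forall t, D t -> f t = f' t) ->
  (forall t, D t -> g t = g' t) -> close f g -> close f' g'.
Proof. by move=> ef eg [K K0 h]; exists K => // t Dt; rewrite -ef -?eg//; exact: h. Qed.

Lemma close_cst a : close (fun=> a) (fun=> a).
Proof. by exists `|a| => // t Dt; rewrite subrr normr0 mulr_ge0 ?w_ge0. Qed.

Lemma closeD f f' g g' : close f g -> close f' g' ->
  close (fun t => f t + f' t) (fun t => g t + g' t).
Proof.
move=> [K K0 h] [K' K0' h']; exists (K + K'); first exact: addr_ge0.
move=> t Dt; have [f1 f2 f3] := h t Dt; have [g1 g2 g3] := h' t Dt.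
rewrite opprD addrACA mulrDl; split; apply: le_trans (ler_normD _ _) _; exact: lerD.
Qed.

Lemma closeM f f' g g' : close f g -> close f' g' ->
  close (fun t => f t * f' t) (fun t => g t * g' t).
Proof.
(* The factor 2 pays for the two terms of f f' - g g' = f (f' - g') + g' (f - g). *)
move=> [K K0 h] [K' K0' h']; exists (2 * (K * K')); first by rewrite !mulr_ge0.
move=> t Dt; have [f1 f2 f3] := h t Dt; have [g1 g2 g3] := h' t Dt.
have KK : K * K' <= 2 * (K * K') by rewrite ler_peMl ?mulr_ge0// ler1n.
split; rewrite ?normrM.
- by apply: le_trans KK; exact: ler_pM.
- by apply: le_trans KK; exact: ler_pM.
rewrite (_ : _ - _ = f t * (f' t - g' t) + g' t * (f t - g t)); last by ring.
apply: le_trans (ler_normD _ _) _; rewrite !normrM.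
rewrite [leRHS](_ : _ = K * (K' * w t) + K' * (K * w t)); last by ring.
by apply: lerD; exact: ler_pM.
Qed.

Lemma close_sum (I : Type) (r : seq I) (P : pred I) (F G : I -> T -> R) :
  (forall i, P i -> close (F i) (G i)) ->
  close (fun t => \sum_(i <- r | P i) F i t) (fun t => \sum_(i <- r | P i) G i t).
Proof.
move=> h; elim: r => [|i r IH].
  by apply: close_ext (close_cst 0) => t _; rewrite big_nil.
have [Pi|Pi] := boolP (P i).
  by apply: close_ext (closeD (h _ Pi) IH) => t _; rewrite big_cons Pi.
by apply: close_ext IH => t _; rewrite big_cons (negbTE Pi).
Qed.

Lemma closeX f g n : close f g -> close (fun t => f t ^+ n) (fun t => g t ^+ n).
Proof.
move=> h; elim: n => [|n IH].
  by apply: close_ext (close_cst 1) => t _; rewrite expr0.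
by apply: close_ext (closeM h IH) => t _; rewrite exprS.
Qed.

(** Coefficientwise closeness, for generating products and characteristic polynomials. *)
Definition pclose (p q : T -> {poly R}) :=
  forall k, close (fun t => (p t)`_k) (fun t => (q t)`_k).

Lemma pclose_cst p : pclose (fun=> p) (fun=> p).
Proof. by move=> k; exact: close_cst. Qed.

Lemma pcloseM p p' q q' : pclose p q -> pclose p' q' ->
  pclose (fun t => p t * p' t) (fun t => q t * q' t).
Proof.
move=> h h' k.
apply: (@close_ext (fun t => \sum_(i < k.+1) (p t)`_i * (p' t)`_(k - i)) _
                   (fun t => \sum_(i < k.+1) (q t)`_i * (q' t)`_(k - i))).
- by move=> t _; rewrite coefM.
- by move=> t _; rewrite coefM.
- by apply: close_sum => i _; exact: closeM.
Qed.

Lemma pcloseD p p' q q' : pclose p q -> pclose p' q' ->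
  pclose (fun t => p t + p' t) (fun t => q t + q' t).
Proof. by move=> h h' k; apply: close_ext (closeD (h k) (h' k)) => t _; rewrite coefD. Qed.

Lemma pclose_sum (I : Type) (r : seq I) (P : pred I) (F G : I -> T -> {poly R}) :
  (forall i, P i -> pclose (F i) (G i)) ->
  pclose (fun t => \sum_(i <- r | P i) F i t) (fun t => \sum_(i <- r | P i) G i t).
Proof.
move=> h k; apply: close_ext (close_sum r (fun i Pi => h i Pi k)) => t _;
  by rewrite coef_sum.
Qed.

Lemma pclose_prod (I : Type) (r : seq I) (P : pred I) (F G : I -> T -> {poly R}) :
  (forall i, P i -> pclose (F i) (G i)) ->
  pclose (fun t => \prod_(i <- r | P i) F i t) (fun t => \prod_(i <- r | P i) G i t).
Proof.
move=> h; elim: r => [|i r IH] k.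
  by apply: close_ext (pclose_cst 1 k) => t _; rewrite big_nil.
have [Pi|Pi] := boolP (P i).
  by apply: close_ext (pcloseM (h _ Pi) IH k) => t _; rewrite big_cons Pi.
by apply: close_ext (IH k) => t _; rewrite big_cons (negbTE Pi).
Qed.

Lemma close_esym d (A : {set 'I_d}) k (x y : T -> 'I_d -> R) :
  (forall i, close (x^~ i) (y^~ i)) ->
  close (fun t => esym A k (x t)) (fun t => esym A k (y t)).
Proof.
move=> h; apply: (@pclose_prod _ _ _ (fun l t => 1 + x t l *: 'X)
  (fun l t => 1 + y t l *: 'X)) => i _.
apply: pcloseD; first exact: pclose_cst.
move=> l; apply: close_ext (closeM (h i) (close_cst ('X`_l))) => t _;
  by rewrite coefZ.
Qed.

Lemma close_char_poly d (M N : T -> 'M[R]_d) :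
  (forall i j, close (fun t => M t i j) (fun t => N t i j)) ->
  pclose (fun t => char_poly (M t)) (fun t => char_poly (N t)).
Proof.
move=> h.
have hij i j : pclose (fun t => char_poly_mx (M t) i j) (fun t => char_poly_mx (N t) i j).
  move=> k; pose c (B : 'M[R]_d) := ('X *+ (i == j))`_k + - 1 * (B i j * (k == 0%N)%:R).
  have e B : c B = (char_poly_mx B i j)`_k.
    by rewrite /c !mxE coefB coefC mulN1r; case: (k == 0%N); rewrite ?mulr1 ?mulr0.
  apply: (@close_ext (fun t => c (M t)) _ (fun t => c (N t))) => [t _|t _|]; rewrite ?e//.
  apply: closeD; first exact: close_cst.
  by apply: closeM; [exact: close_cst|apply: closeM => //; exact: close_cst].
rewrite /char_poly /determinant.
apply: pclose_sum => s _; apply: pcloseM; first exact: pclose_cst.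
by apply: pclose_prod => i _; exact: hij.
Qed.

Lemma close_mulmx d (M N M' N' : T -> 'M[R]_d) :
  (forall i j, close (fun t => M t i j) (fun t => N t i j)) ->
  (forall i j, close (fun t => M' t i j) (fun t => N' t i j)) ->
  forall i j, close (fun t => (M t *m M' t) i j) (fun t => (N t *m N' t) i j).
Proof.
move=> h h' i j.
apply: (@close_ext (fun t => \sum_k M t i k * M' t k j) _
                   (fun t => \sum_k N t i k * N' t k j)).
- by move=> t _; rewrite mxE.
- by move=> t _; rewrite mxE.
- by apply: close_sum => k _; exact: closeM.
Qed.

End Close.

(** * The operator [Tmx] under orthogonal conjugation and on diagonal matrices *)

Section MatrixFlow.
Variables (R : realType) (d : nat).
Implicit Types A P : 'M[R]_d.

(** The eigenvalues are picked by choice, but their symmetric functions are coefficients of the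
    characteristic polynomial. Hence [elemsym_mx] is polynomial in the entries and invariant under
    conjugation. *)
Lemma elemsym_mxE k A : (k <= d)%N ->
  elemsym_mx k A = (-1) ^+ k * (char_poly A)`_(d - k).
Proof.
move=> kd; rewrite /elemsym_mx coef_prod_XsubC_elemsym//.
set S := [set x : 'I_d -> R[i]%C |
  map_poly (real_complex R) (char_poly A) = \prod_(i < d) ('X - (x i)%:P)].
(* The set of admissible eigenvalue lists is inhabited since R[i] is algebraically closed, so [xget]
   does not fall back to its default. *)
have [r hr] := closed_field_poly_normal (map_poly (real_complex R) (char_poly A)).
have Sr : S (fun i => nth 0 r i).
  have mon : map_poly (real_complex R) (char_poly A) \is monic.
    by rewrite map_monic char_poly_monic.
  rewrite /S /= {1}hr (monicP mon) scale1r.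
  have sr : size r = d.
    have := size_char_poly A; rewrite -(size_map_poly (real_complex R)) hr.
    by rewrite (monicP mon) scale1r size_prod_XsubC => -[].
  by rewrite (big_nth 0) sr big_mkord.
have <- : map_poly (real_complex R) (char_poly A) = \prod_(i < d) ('X - (eigenvals A i)%:P).
  exact: (xgetPex (fun=> 0) (ex_intro _ _ Sr)).
(* The coefficient lies in the image of R, where [Re] undoes the embedding. *)
by rewrite coef_map /= -[in X in X * _](rmorph_sign (real_complex R)) -rmorphM.
Qed.

Lemma char_poly_conj P A : P^T *m P = 1%:M -> char_poly (P^T *m A *m P) = char_poly A.
Proof.
move=> PP; have PP' := mulmx1C PP.
have e : char_poly_mx (P^T *m A *m P) =
    map_mx polyC P^T *m char_poly_mx A *m map_mx polyC P.
  rewrite /char_poly_mx mulmxBr mulmxBl !map_mxM; congr (_ - _).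
  by rewrite mul_mx_scalar -scalemxAl -map_mxM PP map_mx1 scalemx1.
rewrite /char_poly e !det_mulmx mulrAC -det_mulmx -map_mxM PP.
by rewrite map_mx1 det1 mul1r.
Qed.

Lemma Tmx_conj k P A : (k <= d)%N -> P^T *m P = 1%:M ->
  Tmx k (P^T *m A *m P) = P^T *m Tmx k A *m P.
Proof.
move=> kd PP; have PP' := mulmx1C PP.
rewrite /Tmx mulmx_sumr mulmx_suml; apply: eq_bigr => l _.
have kl : (k - l <= d)%N by rewrite (leq_trans _ kd) ?leq_subr.
rewrite -scalemxAr -scalemxAl !elemsym_mxE// char_poly_conj//; congr (_ *: _).
elim: (val l) => [|m IH]; first by rewrite !expr0 mulmx1 PP.
by rewrite !exprS IH -!mulmxE !mulmxA -[_ *m P *m P^T]mulmxA PP' mulmx1.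
Qed.

Lemma Tmx_diag k (x : 'I_d -> R) : (k <= d)%N ->
  Tmx k (diag_mx (\row_i x i)) = diag_mx (\row_i elemsym k (omit i x)).
Proof.
move=> kd; apply/matrixP => i j; rewrite /Tmx summxE [RHS]mxE.
have pow l : diag_mx (\row_i x i) ^+ l = diag_mx (\row_i x i ^+ l).
  elim: l => [|l IH]; first by apply/matrixP => a b; rewrite expr0 !mxE.
  rewrite exprS IH -mulmxE mulmx_diag; congr diag_mx; apply/rowP => a.
  by rewrite !mxE exprS.
have cp : char_poly (diag_mx (\row_i x i)) = \prod_(i < d) ('X - (x i)%:P).
  rewrite char_poly_trig ?diag_mx_is_trig//; apply: eq_bigr => a _.
  by rewrite !mxE eqxx.
rewrite mxE -elemsym_cancel.
have [<-|ij] := eqVneq i j; last first.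
  by rewrite mulr0n big1// => l _; rewrite pow !mxE (negbTE ij) mulr0n mulr0.
rewrite mulr1n; apply: eq_bigr => l _.
have kl : (k - l <= d)%N by rewrite (leq_trans _ kd) ?leq_subr.
rewrite mxE elemsym_mxE// cp -coef_prod_XsubC_elemsym// pow !mxE eqxx mulr1n.
by [].
Qed.

End MatrixFlow.

(** * Uniqueness of the matrix flow *)

Section MatrixUniqueness.
Variable R : realType.

(** The first hypothesis is a local Lipschitz condition on F, obtained by taking for w the Frobenius
    distance between M and N. The squared distance V then satisfies V' <= C V with V(0) = 0, and a
    Gronwall argument gives V = 0. *)
Lemma matrix_flow_unique d (F : 'M[R]_d -> 'M[R]_d) (M N : R -> 'M[R]_d) :
  (forall (w : R -> R) (D : set R), (forall t, D t -> 0 <= w t) ->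
     (forall i j, close w D (fun t => M t i j) (fun t => N t i j)) ->
     forall i j, close w D (fun t => F (M t) i j) (fun t => F (N t) i j)) ->
  (forall i j, deriv_pos (fun t => M t i j) (fun t => F (M t) i j)) ->
  (forall i j, deriv_pos (fun t => N t i j) (fun t => F (N t) i j)) ->
  M 0 = N 0 -> forall t, 0 <= t -> M t = N t.
Proof.
move=> lipF dM dN MN0 b b0.
pose V t := \sum_i \sum_j (M t i j - N t i j) * (M t i j - N t i j).
have V_ge i j t : (M t i j - N t i j) ^+ 2 <= V t.
  rewrite /V (bigD1 i) //= (bigD1 j) //= -expr2 -addrA lerDl addr_ge0// !sumr_ge0// => l _.
    by rewrite -expr2 sqr_ge0.
  by apply: sumr_ge0 => m _; rewrite -expr2 sqr_ge0.
have V_ge0 t : 0 <= V t.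
  by do 2 (apply: sumr_ge0 => ? _); rewrite -expr2 sqr_ge0.
pose w t := Num.sqrt (V t).
have diffw i j t : `|M t i j - N t i j| <= w t.
  by rewrite -sqrtr_sqr ler_wsqrtr.
pose D := [set t : R | 0 <= t <= b].
have w0 t : D t -> 0 <= w t by move=> _; exact: sqrtr_ge0.
have cMN i j : close w D (fun t => M t i j) (fun t => N t i j).
  have [K hK] := deriv_pos_bounded b (dM i j).
  have [L hL] := deriv_pos_bounded b (dN i j).
  (* The summand 1 makes the constant at least 1, as needed for the bound of the difference by w
     itself. *)
  exists (`|K| + `|L| + 1) => [|t Dt]; first by rewrite !addr_ge0.
  have K1 := ler_norm K; have L1 := ler_norm L.
  have K0 := normr_ge0 K; have L0 := normr_ge0 L.
  have h1 := hK _ Dt; have h2 := hL _ Dt.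
  split; [lra|lra|].
  by apply: le_trans (diffw i j t) _; rewrite ler_peMl ?w0//; lra.
have cF p : exists K, 0 <= K /\ forall t, D t ->
    `|F (M t) p.1 p.2 - F (N t) p.1 p.2| <= K * w t.
  have [K K0 hK] := lipF _ _ w0 cMN p.1 p.2.
  by exists K; split=> // t /hK[].
have [K hK] := choice cF.
(* Each term of V' is at most 2 w (K w) = 2 K V. *)
pose C := \sum_i \sum_j 2 * K (i, j).
have dV : deriv_pos V (fun t => \sum_i \sum_j 2 *
    ((M t i j - N t i j) * (F (M t) i j - F (N t) i j))).
  apply: (@deriv_pos_sum _ _ _ _ (fun i t => \sum_j (M t i j - N t i j) * (M t i j - N t i j))) => i.
  apply: (@deriv_pos_sum _ _ _ _ (fun j t => (M t i j - N t i j) * (M t i j - N t i j))) => j.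
  have dMN := deriv_posB (dM i j) (dN i j).
  by apply: deriv_pos_ext (deriv_posM dMN dMN) => t _; ring.
have V0 : V 0 = 0.
  by rewrite /V; do 2 (rewrite big1// => ? _); rewrite MN0 subrr mulr0.
have : 0 <= - V b.
  apply: (deriv_pos_ge0 (K := C) (deriv_posN dV) (lexx 0)) => //; first by rewrite V0 oppr0.
  move=> t t0 tb _; rewrite mulrN lerN2 mulr_suml; apply: ler_sum => i _.
  rewrite mulr_suml; apply: ler_sum => j _; rewrite -mulrA ler_pM2l//.
  apply: le_trans (ler_norm _) _; rewrite normrM.
  have [K0 hF] := hK (i, j).
  have Dt : D t by rewrite /D /= !ltW.
  rewrite -[V t](sqr_sqrtr (V_ge0 t)) expr2 mulrCA; apply: ler_pM => //.
  exact: hF.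
rewrite oppr_ge0 => Vb; apply/matrixP => i j; apply/eqP.
by rewrite -subr_eq0 -sqrf_eq0 eq_le sqr_ge0 andbT (le_trans (V_ge i j b)).
Qed.

(** The entries of [Tmx] are polynomials in those of the matrix, by way of the characteristic
    polynomial; this provides the Lipschitz condition for uniqueness. *)
Lemma Tmx_close d k (w : R -> R) (D : set R) (M N : R -> 'M[R]_d) :
  (k <= d)%N -> (forall t, D t -> 0 <= w t) ->
  (forall i j, close w D (fun t => M t i j) (fun t => N t i j)) ->
  forall i j, close w D (fun t => Tmx k (M t) i j) (fun t => Tmx k (N t) i j).
Proof.
move=> kd w0 h i j.
have cX l a b : close w D (fun t => (M t ^+ l) a b) (fun t => (N t ^+ l) a b).
  elim: l a b => [|l IH] a b.
    by apply: close_ext (close_cst w0 ((1%:M : 'M[R]_d) a b)) => t _; rewrite expr0.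
  by apply: close_ext (close_mulmx w0 h IH a b) => t _; rewrite exprS.
pose c l (A : 'M[R]_d) := (-1) ^+ l * ((-1) ^+ (k - l) * (char_poly A)`_(d - (k - l))).
have e A : Tmx k A i j = \sum_(l < k.+1) c l A * (A ^+ l) i j.
  rewrite /Tmx summxE; apply: eq_bigr => l _.
  by rewrite mxE elemsym_mxE// (leq_trans _ kd)// leq_subr.
apply: (@close_ext _ _ _ _ (fun t => \sum_(l < k.+1) c l (M t) * (M t ^+ l) i j) _
  (fun t => \sum_(l < k.+1) c l (N t) * (N t ^+ l) i j)) => [t _|t _|]; rewrite ?e//.
apply: close_sum => // l _; apply: closeM => //.
do 2 (apply: closeM => //; first exact: close_cst).
exact: close_char_poly.
Qed.

(** If M is symmetric and M^2 = 0, the diagonal entries of M^2 are sums of squares of columns, so M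
    = 0. Raising the exponent to a power of 2 lets this be applied repeatedly, halving the
    exponent. *)
Lemma sym_nilp_eq0 d (N : 'M[R]_d) m : N^T = N -> N ^+ m = 0 -> N = 0.
Proof.
move=> sN Nm.
have : N ^+ (2 ^ m) = 0.
  by rewrite -(subnK (ltnW (ltn_expl m (ltnSn 1)))) exprD Nm mulr0.
elim: m {Nm} => [|m IH]; first by rewrite expn0 expr1.
rewrite expnS mulnC exprM expr2 => h; apply: IH; move: h.
set M := N ^+ _ => MM.
have sM : M^T = M.
  rewrite /M; elim: (2 ^ m)%N => [|l IH]; first by rewrite expr0 trmx1.
  by rewrite exprS -mulmxE trmx_mul IH sN mulmxE -exprSr exprS.
apply/matrixP => i j; rewrite mxE.
have : \sum_l M l j ^+ 2 = 0.
  have MMj : (M *m M) j j = 0 by rewrite mulmxE MM mxE.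
  rewrite -[RHS]MMj mxE.
  by apply: eq_bigr => l _; rewrite expr2 -[in X in _ = X * _]sM mxE.
move/eqP; rewrite psumr_eq0 => [/allP/(_ i)|l _]; last exact: sqr_ge0.
by rewrite mem_index_enum sqrf_eq0 => /(_ isT)/eqP.
Qed.

(** By Cayley-Hamilton A - a I is nilpotent, and it is symmetric. This takes the place of
    diagonalization in showing that a nonscalar initial matrix has two distinct eigenvalues. *)
Lemma sym_char_poly_scalar d (A : 'M[R]_d) (a : R) : A^T = A ->
  char_poly A = \prod_(i < d) ('X - a%:P) -> A = a *: 1%:M.
Proof.
case: d A => [|d] A sA; first by move=> _; apply/matrixP => -[].
rewrite big_const_ord iter_mulr_1 => cA.
have := Cayley_Hamilton A; rewrite cA rmorphXn rmorphB /= horner_mx_X horner_mx_C.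
move/(sym_nilp_eq0 _) => h.
by apply/eqP; rewrite scalemx1 -subr_eq0; apply/eqP/h; rewrite linearB /= sA tr_scalar_mx.
Qed.

Lemma char_poly_scalar_eq d (a : R) (x : 'I_d -> R) :
  char_poly (a *: 1%:M : 'M[R]_d) = \prod_(i < d) ('X - (x i)%:P) ->
  forall i, x i = a.
Proof.
move=> h i; have : root (char_poly (a *: 1%:M : 'M[R]_d)) (x i).
  by rewrite h rootE horner_prod (bigD1 i)//= !hornerE subrr mul0r.
rewrite scalemx1 char_poly_trig ?scalar_mx_is_trig// rootE horner_prod prodf_seq_eq0.
by move=> /hasP[j _] /=; rewrite !hornerE mxE eqxx mulr1n subr_eq0 => /eqP.
Qed.

End MatrixUniqueness.

(** * Perturbed linear scalar equations *)

Section LinearDecay.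
Variable R : realType.
Implicit Types (u p q r g : R -> R) (a b t K : R).

(** The multiple of e^(-bt) on the right is a barrier: where u lies above it, u decreases at least
    as fast. In its constant, M0 absorbs the forcing r and the other term places the barrier above u
    at t0. *)
Lemma linear_decay_le u q r m b K M0 t0 :
  deriv_pos u (fun t => - q t * u t + r t) -> 0 <= t0 -> 0 <= M0 ->
  (forall t, t0 <= t -> m <= q t) ->
  (forall t, t0 <= t -> `|r t| <= K * expR (- b * t)) ->
  0 <= b -> b <= m -> K <= (m - b) * M0 ->
  forall t, t0 <= t -> u t <= (M0 + `|u t0| * expR (b * t0)) * expR (- b * t).
Proof.
move=> du t00 M00 hq hr b0 bq hK t t0t; set M := M0 + _.
have M_ge : M0 <= M by rewrite lerDl mulr_ge0 ?expR_ge0.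
have K_le : K <= (m - b) * M by rewrite (le_trans hK)// ler_wpM2l// subr_ge0.
rewrite -subr_ge0.
apply: (deriv_pos_ge0 (K := 0) (deriv_posB (deriv_posZ M (deriv_pos_expRM (- b))) du) t00) => //.
  rewrite /M mulrDl -mulrA -expRD mulNr subrr expR0 mulr1.
  by rewrite -addrA addr_ge0 ?mulr_ge0 ?expR_ge0// subr_ge0 ler_norm.
move=> s t0s _; rewrite mul0r subr_lt0 => us.
have e0 := expR_ge0 (- b * s).
have := hr s (ltW t0s); rewrite ler_norml => /andP[_ rs].
have Me0 : 0 <= M * expR (- b * s) by rewrite mulr_ge0// (le_trans M00).
have h1 : m * (M * expR (- b * s)) <= q s * u s.
  apply: (@le_trans _ _ (m * u s)); first by rewrite ler_wpM2l ?(le_trans b0)// ltW.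
  by rewrite ler_wpM2r ?hq ?(ltW t0s)// (le_trans Me0)// ltW.
have h2 : K * expR (- b * s) <= (m - b) * M * expR (- b * s) by rewrite ler_wpM2r.
lra.
Qed.

Lemma linear_decay u q r m b K M0 t0 :
  deriv_pos u (fun t => - q t * u t + r t) -> 0 <= t0 -> 0 <= M0 ->
  (forall t, t0 <= t -> m <= q t) ->
  (forall t, t0 <= t -> `|r t| <= K * expR (- b * t)) ->
  0 <= b -> b <= m -> K <= (m - b) * M0 ->
  exists2 M, 0 <= M & forall t, t0 <= t -> `|u t| <= M * expR (- b * t).
Proof.
move=> du t00 M00 hq hr b0 bq hK; exists (M0 + `|u t0| * expR (b * t0)).
  by rewrite addr_ge0 ?mulr_ge0 ?expR_ge0.
move=> t t0t; rewrite ler_norml; apply/andP; split.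
  2: exact: (linear_decay_le du t00 M00 hq hr b0 bq hK).
rewrite lerNl -(normrN (u t0)).
apply: (@linear_decay_le (fun t => - u t) q (fun t => - r t) m b K M0 t0) => //.
  by apply: deriv_pos_ext (deriv_posN du) => s _; rewrite opprD mulrN.
by move=> s hs; rewrite normrN hr.
Qed.

(** The square of g stays above g(0)^2 e^(-2Kt). It allows the asymptotics to start at time 1 from a
    nonzero value. *)
Lemma linear_neq0 g p K b : deriv_pos g (fun t => - p t * g t) -> 0 <= b ->
  (forall t, 0 <= t <= b -> `|p t| <= K) -> g 0 != 0 -> g b != 0.
Proof.
move=> dg b0 hp g0; rewrite -sqrf_eq0 gt_eqF// expr2.
have := mulr_gt0 (_ : 0 < g 0 * g 0) (expR_gt0 (- (2 * K) * b)).
rewrite -expr2 lt_def sqr_ge0 sqrf_eq0 g0 => /(_ isT) h; apply: lt_le_trans h _.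
rewrite -subr_ge0.
apply: (deriv_pos_ge0 (K := 0) (deriv_posB (deriv_posM dg dg)
  (deriv_posZ (g 0 ^+ 2) (deriv_pos_expRM (- (2 * K))))) (lexx 0) b0).
  by rewrite mulr0 expR0 mulr1 expr2 subrr.
move=> t t0 tb; rewrite mul0r subr_lt0 => gt.
have pK := hp t (introT andP (conj (ltW t0) (ltW tb))).
have K0 := le_trans (normr_ge0 _) pK.
have h1 : p t * (g t * g t) <= K * (g t * g t).
  by rewrite ler_wpM2r -?expr2 ?sqr_ge0// (le_trans (ler_norm _)).
have h2 : K * (g t * g t) <= K * (g 0 ^+ 2 * expR (- (2 * K) * t)).
  by rewrite ler_wpM2l// ltW.
nra.
Qed.

(* The two multipliers are e^(-2at) times exponentials of bounded functions
   whose derivatives absorb the perturbation [p - a]. *)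
Lemma linear_asymp g p a b K : deriv_pos g (fun t => - p t * g t) ->
  0 <= a -> 0 < b -> 0 <= K ->
  (forall t, 1 <= t -> `|p t - a| <= K * expR (- b * t)) -> g 1 != 0 ->
  exists c C, [/\ 0 < c, 0 < C & forall t, 1 <= t ->
    c * expR (- a * t) <= `|g t| <= C * expR (- a * t)].
Proof.
move=> dg a0 b0 K0 hp g1.
(* With s = 1 this decays at least as fast as g^2 and with s = -1 at most as fast, whence the lower
   and the upper bound. *)
pose psi s t := expR (- (2 * a) * t + s * (2 * K / b) * expR (- b * t)).
have dpsi s : deriv_pos (psi s) (fun t => (- (2 * a) - s * (2 * K) * expR (- b * t)) * psi s t).
  apply: deriv_pos_ext (deriv_pos_expR (deriv_posD (deriv_posZ (- (2 * a)) _)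
    (deriv_posZ (s * (2 * K / b)) (deriv_pos_expRM (- b))))); last first.
    by split=> [t|t _]; [exact: cvg_id|exact: is_derive_id].
  by move=> t _; congr (_ * _); field; exact: lt0r_neq0.
have psi_gt0 s t : 0 < psi s t by exact: expR_gt0.
have g2_gt0 : 0 < g 1 * g 1 by rewrite -expr2 lt_def sqr_ge0 sqrf_eq0 g1.
have lo t : 1 <= t -> g 1 * g 1 / psi 1 1 * psi 1 t <= g t * g t.
  move=> t1; rewrite -subr_ge0.
  apply: (deriv_pos_ge0 (K := 0) (deriv_posB (deriv_posM dg dg)
    (deriv_posZ (g 1 * g 1 / psi 1 1) (dpsi 1))) ler01 t1).
    by rewrite divfK ?gt_eqF// subrr.
  move=> s s1 _; rewrite mul0r subr_lt0.
  set y := g 1 * g 1 / psi 1 1 * psi 1 s => gy.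
  have := hp s (ltW s1); rewrite ler_norml => /andP[_ ps].
  have e0 := expR_ge0 (- b * s).
  have h1 : (p s - a) * (g s * g s) <= K * expR (- b * s) * (g s * g s).
    by rewrite ler_wpM2r// -expr2 sqr_ge0.
  have h2 : (a + K * expR (- b * s)) * (g s * g s) <= (a + K * expR (- b * s)) * y.
    by rewrite ler_wpM2l ?(ltW gy)// addr_ge0// mulr_ge0.
  rewrite [X in _ <= _ - X](_ : _ = (- (2 * a) - 1 * (2 * K) * expR (- b * s)) * y).
    lra.
  by rewrite /y; ring.
have up t : 1 <= t -> g t * g t <= g 1 * g 1 / psi (-1) 1 * psi (-1) t.
  move=> t1; rewrite -subr_ge0.
  (* Here a - K e^(-bt) may be negative; adding K to it makes the coefficient nonnegative, so the
     comparison uses 2 K instead of 0. *)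
  apply: (deriv_pos_ge0 (K := 2 * K) (deriv_posB
    (deriv_posZ (g 1 * g 1 / psi (-1) 1) (dpsi (-1))) (deriv_posM dg dg)) ler01 t1).
    by rewrite divfK ?gt_eqF// subrr.
  move=> s s1 _; rewrite subr_lt0.
  set y := g 1 * g 1 / psi (-1) 1 * psi (-1) s => gy.
  have := hp s (ltW s1); rewrite ler_norml => /andP[ps _].
  have e0 := expR_ge0 (- b * s).
  have e1 : expR (- b * s) <= 1.
    by rewrite -expR0 ler_expR mulNr oppr_le0 mulr_ge0 ?(ltW b0)// ltW// (lt_trans ltr01).
  have h1 : - (K * expR (- b * s)) * (g s * g s) <= (p s - a) * (g s * g s).
    by rewrite ler_wpM2r// -expr2 sqr_ge0.
  have h2 : (K * (1 - expR (- b * s)) + a) * y <= (K * (1 - expR (- b * s)) + a) * (g s * g s).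
    by rewrite ler_wpM2l ?(ltW gy)// addr_ge0// mulr_ge0// subr_ge0.
  rewrite [X in _ <= X - _](_ : _ = (- (2 * a) - -1 * (2 * K) * expR (- b * s)) * y).
    lra.
  by rewrite /y; ring.
have sq t : expR (- (2 * a) * t) = expR (- a * t) ^+ 2.
  by rewrite expr2 -expRD; congr expR; ring.
exists (Num.sqrt (g 1 * g 1 / psi 1 1)), (Num.sqrt (g 1 * g 1 / psi (-1) 1)).
split=> [||t t1]; rewrite ?sqrtr_gt0 ?divr_gt0//.
have e2 : 0 <= 2 * K / b * expR (- b * t).
  by rewrite mulr_ge0 ?expR_ge0// divr_ge0 ?(ltW b0)// mulr_ge0.
rewrite -sqrtr_sqr -[expR (- a * t)]ger0_norm ?expR_ge0// -sqrtr_sqr -sq.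
rewrite -!sqrtrM ?(ltW (divr_gt0 _ _))//.
apply/andP; split; rewrite ler_wsqrtr// expr2.
  apply: le_trans (lo t t1); rewrite ler_pM2l ?divr_gt0// ler_expR lerDl.
  by rewrite mul1r.
apply: le_trans (up t t1) _; rewrite ler_pM2l ?divr_gt0// ler_expR gerDl.
by rewrite mulN1r mulNr oppr_le0.
Qed.

(** After taking logarithms the multiplicative constants contribute ln c / t and ln C / t, which
    vanish in the limit. *)
Lemma asymp_equiv_expR_lnv (f : R -> R) a :
  asymp_equiv f (fun t => expR (- a * t)) -> t^-1 * ln (f t) @[t --> +oo] --> - a.
Proof.
move=> [c [C [t0 [c0 C0 t00 h]]]].
pose lo t := ln c * t^-1 - a; pose up t := ln C * t^-1 - a.
have inv0 : (t^-1 : R) @[t --> +oo] --> (0 : R).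
  apply/(@gtr0_cvgV0 _ _ _ _ id); last exact: cvg_id.
  by near=> t; near: t; exact: nbhs_pinfty_gt.
have cvgl (x : R) : ln x * t^-1 - a @[t --> +oo] --> - a.
  have : ln x * t^-1 - a @[t --> +oo] --> ln x * 0 - a.
    apply: cvgB; last exact: cvg_cst.
    by apply: cvgM; [exact: cvg_cst|exact: inv0].
  by rewrite mulr0 sub0r.
apply: (@squeeze_cvgr _ _ _ _ lo up); [|exact: cvgl|exact: cvgl].
near=> t.
have tt0 : t0 <= t by near: t; apply: nbhs_pinfty_ge; exact: num_real.
have t_gt0 : 0 < t by exact: lt_le_trans tt0.
have [h1 h2] := h t tt0.
have e0 := expR_gt0 (- a * t).
have f0 : 0 < f t by apply: lt_le_trans h1; rewrite mulr_gt0.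
have e (x : R) : 0 < x -> ln x * t^-1 - a = t^-1 * ln (x * expR (- a * t)).
  by move=> x0; rewrite lnM ?posrE// expRK; field; exact: lt0r_neq0.
rewrite /lo /up !e// !ler_pM2l ?invr_gt0// !ler_ln ?posrE ?mulr_gt0// h1 h2 //.
Unshelve. all: by end_near.
Qed.

End LinearDecay.

(** * The eigenvalue flow *)

Section EigenFlow.
Variables (R : realType) (d k : nat) (c gamma : R) (x : R -> 'I_d -> R).
Hypotheses (kd : (k.+1 < d)%N) (c_gt0 : 0 < c) (gamma_gt0 : 0 < gamma).
Hypothesis dx : forall i, deriv_pos (x^~ i)
  (fun t => - c * x t i * elemsym k (omit i (x t)) + 2 * gamma).
Hypothesis x0_ge0 : forall i, 0 <= x 0 i.
Implicit Types (t b : R) (i j : 'I_d) (A : {set 'I_d}).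

Lemma esym_flow_bounded A b :
  exists2 K, 0 <= K & forall t, 0 <= t <= b -> `|esym A k (x t)| <= K.
Proof.
(* With w = 0, closeness of the flow to itself is mere boundedness, which passes from x to e_k. *)
have w0 t : [set t | 0 <= t <= b] t -> (0 : R) <= 0 by [].
have cx i : close (fun=> 0) [set t | 0 <= t <= b] (x^~ i) (x^~ i).
  have [K hK] := deriv_pos_bounded b (dx i).
  exists `|K| => // t /hK h; rewrite subrr normr0 mulr0.
  by split=> //; rewrite (le_trans h)// ler_norm.
by have [K K0 hK] := close_esym w0 A k cx; exists K => // t /hK[].
Qed.

Lemma flow_ge0 i b : 0 <= b -> 0 <= x b i.
Proof.
move=> b0; have [K K0 hK] := esym_flow_bounded [set~ i]%SET b.
(* The sign of e_k is not known before the eigenvalues are known to be nonnegative, so only its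
   bound K is used. *)
apply: (deriv_pos_ge0 (K := c * K) (dx i) (lexx 0) b0) => // t t0 tb xt.
have := hK t (introT andP (conj (ltW t0) (ltW tb))); rewrite ler_norml => /andP[eK _].
rewrite elemsym_omit; set e := esym _ _ _ in eK *.
have : c * (- x t i) * (K + e) >= 0.
  rewrite mulr_ge0//; last by lra.
  by rewrite mulr_ge0 ?(ltW c_gt0)// oppr_ge0 ltW.
by have := ltW gamma_gt0; lra.
Qed.

Lemma esym_flow_ge0 A l t : 0 <= t -> 0 <= esym A l (x t).
Proof.
move=> t0; have h i : i \in A -> 0 <= x t i <= x t i by rewrite flow_ge0// lexx.
by have /andP[] := esym_le l h.
Qed.

Lemma esym_flow_const_le A l t (a : R) : 0 <= t -> (forall i, x t i <= a) ->
  esym A l (x t) <= 'C(#|A|, l)%:R * a ^+ l.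
Proof.
move=> t0 xa; rewrite -esym_const; 
have h i : i \in A -> 0 <= x t i <= a by rewrite flow_ge0//= xa.
by have /andP[] := esym_le l h.
Qed.

Lemma const_le_esym_flow A l t (a : R) : 0 <= a -> (forall i, a <= x t i) ->
  'C(#|A|, l)%:R * a ^+ l <= esym A l (x t).
Proof.
move=> a0 xa; rewrite -esym_const; 
have h i : i \in A -> 0 <= a <= x t i by rewrite a0 xa.
by have /andP[] := esym_le l h.
Qed.

Lemma deriv_pos_flow_diff i j : i != j ->
  deriv_pos (fun t => x t i - x t j)
    (fun t => - (c * esym (~: [set i; j])%SET k (x t)) * (x t i - x t j)).
Proof.
move=> ij; apply: deriv_pos_ext (deriv_posB (dx i) (dx j)) => t _.
have e := esym_diff k (x t) ij; 
rewrite [RHS](_ : _ = - c * ((x t i - x t j) * esym (~: [set i; j])%SET k (x t))); last by ring.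
by rewrite -e; ring.
Qed.

Lemma flow_order i j b : x 0 j <= x 0 i -> 0 <= b -> x b j <= x b i.
Proof.
have [->//|ij] := eqVneq i j.
move=> h b0; have [K K0 hK] := esym_flow_bounded (~: [set i; j])%SET b.
rewrite -subr_ge0.
apply: (deriv_pos_ge0 (K := c * K) (deriv_pos_flow_diff ij) (lexx 0) b0).
  by rewrite subr_ge0.
move=> t t0 tb xt.
have := hK t (introT andP (conj (ltW t0) (ltW tb))); rewrite ler_norml => /andP[eK _].
set e := esym _ _ _ in eK *.
have : c * (- (x t i - x t j)) * (K + e) >= 0.
  rewrite mulr_ge0//; last by lra.
  by rewrite mulr_ge0 ?(ltW c_gt0)// oppr_ge0 ltW.
lra.
Qed.

Lemma flow_eq i j b : x 0 i = x 0 j -> 0 <= b -> x b i = x b j.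
Proof. by move=> e b0; apply/le_anti/andP; split; apply: flow_order => //; rewrite e. Qed.

Lemma flow_diff_le i j b : x 0 j <= x 0 i -> 0 <= b ->
  x b i - x b j <= x 0 i - x 0 j.
Proof.
have [->|ij] := eqVneq i j; first by rewrite !subrr.
move=> h b0; rewrite -subr_ge0.
apply: (deriv_pos_ge0 (K := 0) (deriv_posB (deriv_pos_cst (x 0 i - x 0 j))
  (deriv_pos_flow_diff ij)) (lexx 0) b0); first by rewrite subrr.
move=> t t0 tb xt; rewrite mul0r sub0r mulNr opprK mulr_ge0//.
  by rewrite mulr_ge0 ?esym_flow_ge0 ?(ltW t0)// ltW.
by rewrite subr_ge0 flow_order// ltW.
Qed.

(** On a constant spectrum the flow reads x' = - cbin x^(k+1) + 2 gamma; the number [ls] below is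
    its positive equilibrium. *)
Definition cbin := c * 'C(d.-1, k)%:R.

Lemma cbin_gt0 : 0 < cbin.
Proof. by rewrite mulr_gt0// ltr0n bin_gt0 -ltnS (ltn_predK kd) ltnW. Qed.

Lemma card_setC1 i : #|[set~ i]%SET| = d.-1.
Proof. by rewrite cardsC1 card_ord. Qed.

Lemma card_setC2 i j : i != j -> #|(~: [set i; j])%SET| = (d - 2)%N.
Proof. by move=> ij; rewrite cardsCs finset.setCK card_ord cards2 ij. Qed.

Variable ls : R.
Hypotheses (ls_gt0 : 0 < ls) (lsE : cbin * ls ^+ k.+1 = 2 * gamma).

Lemma flow_min : exists m, forall i, x 0 m <= x 0 i.
Proof.
have i0 : 'I_d by exists 0%N; exact: ltn_trans kd.
exists [arg min_(i < i0) x 0 i]%O => i.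
by case: arg_minP => // j _; apply.
Qed.

(* If m is the smallest eigenvalue, e_k of the others is at least C(d-1,k) m^k, so
   m cannot rise above max (m(0), ls); the other eigenvalues stay within the
   initial spread of m. *)
Lemma flow_bounded : exists2 B, 0 < B & forall t i, 0 <= t -> x t i <= B.
Proof.
have [m hm] := flow_min.
pose B0 := Num.max (x 0 m) ls.
have B0_gt0 : 0 < B0 by rewrite lt_max ls_gt0 orbT.
have xm b : 0 <= b -> x b m <= B0.
  move=> b0; rewrite -subr_ge0.
  apply: (deriv_pos_ge0 (K := 0) (deriv_posB (deriv_pos_cst B0) (dx m)) (lexx 0) b0).
    by rewrite subr_ge0 le_max lexx.
  move=> t t0 tb; rewrite subr_lt0 mul0r sub0r => Bx.
  have xt i : x t m <= x t i by rewrite flow_order// ltW.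
  have := @const_le_esym_flow [set~ m]%SET k t _ (flow_ge0 m (ltW t0)) xt.
  rewrite card_setC1 elemsym_omit; set e := esym _ _ _ => he.
  have lsx : ls <= x t m by rewrite (le_trans _ (ltW Bx))// le_max lexx orbT.
  have h1 : c * x t m * ('C(d.-1, k)%:R * x t m ^+ k) <= c * x t m * e.
    by rewrite ler_wpM2l// mulr_ge0 ?(ltW c_gt0) ?flow_ge0 ?(ltW t0).
  have h2 : cbin * ls ^+ k.+1 <= cbin * x t m ^+ k.+1.
    rewrite ler_pM2l ?cbin_gt0//; apply: lerXn2r => //; rewrite nnegrE ?flow_ge0 ?(ltW t0)// ltW//.
  have h3 : c * x t m * ('C(d.-1, k)%:R * x t m ^+ k) = cbin * x t m ^+ k.+1.
    by rewrite /cbin exprS; ring.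
  by rewrite h3 in h1; rewrite lsE in h2; lra.
pose S := \sum_i x 0 i.
have S_ge0 : 0 <= S by apply: sumr_ge0.
exists (B0 + S) => [|t i t0]; first by rewrite ltr_wpDr.
have := flow_diff_le (hm i) t0; have := xm t t0; have := x0_ge0 m.
have : x 0 i <= S by rewrite /S (bigD1 i)//= lerDl sumr_ge0.
lra.
Qed.

(** With all eigenvalues at most B one has x' >= 2 gamma - M x, so x dominates the solution of the
    linear equation issued from 0. An eigenvalue may vanish at time 0, which is why the bound starts
    at time 1. *)
Lemma flow_bounded_below : exists2 a, 0 < a & forall t i, 1 <= t -> a <= x t i.
Proof.
have [B B0 hB] := flow_bounded.
pose M := cbin * B ^+ k.
have M0 : 0 < M by rewrite mulr_gt0 ?cbin_gt0// exprn_gt0.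
have lo b i : 0 <= b -> 2 * gamma / M * (1 - expR (- M * b)) <= x b i.
  move=> b0; rewrite -subr_ge0.
  apply: (deriv_pos_ge0 (K := 0) (deriv_posB (dx i) (deriv_posZ (2 * gamma / M)
    (deriv_posB (deriv_pos_cst 1) (deriv_pos_expRM (- M))))) (lexx 0) b0).
    by rewrite mulr0 expR0 subrr mulr0 subr0.
  move=> t t0 tb; rewrite mul0r sub0r subr_lt0 elemsym_omit => xt.
  have xt0 := flow_ge0 i (ltW t0).
  have := @esym_flow_const_le [set~ i]%SET k t B (ltW t0) (fun i => hB t i (ltW t0)).
  rewrite card_setC1; set e := esym _ _ _ => he.
  have h1 : c * x t i * e <= c * x t i * ('C(d.-1, k)%:R * B ^+ k).
    by rewrite ler_wpM2l// mulr_ge0// ltW.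
  have h2 : c * x t i * ('C(d.-1, k)%:R * B ^+ k) = M * x t i.
    by rewrite /M /cbin; ring.
  have h3 : M * x t i <= M * (2 * gamma / M * (1 - expR (- M * t))).
    by rewrite ler_pM2l// ltW.
  have h4 : M * (2 * gamma / M * (1 - expR (- M * t))) = 2 * gamma * (1 - expR (- M * t)).
    by field; exact: lt0r_neq0.
  have h5 : 2 * gamma / M * - (- M * expR (- M * t)) = 2 * gamma * expR (- M * t).
    by field; exact: lt0r_neq0.
  rewrite h5; rewrite h2 in h1; rewrite h4 in h3.
  lra.
exists (2 * gamma / M * (1 - expR (- M))).
  apply: mulr_gt0; first by apply: divr_gt0 => //; apply: mulr_gt0.
  by rewrite subr_gt0 -[ltRHS]expR0 ltr_expR oppr_lt0.
move=> t i t1; apply: le_trans (lo t i (le_trans ler01 t1)).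
apply: ler_wpM2l.
  by apply: divr_ge0; [apply: mulr_ge0 => //; exact: ltW|exact: ltW].
rewrite lerB// ler_expR.
by rewrite mulNr lerN2 ler_peMr// ltW.
Qed.

Lemma flow_diff_decay : exists2 b, 0 < b & exists2 K, 0 <= K &
  forall t i j, 1 <= t -> `|x t i - x t j| <= K * expR (- b * t).
Proof.
have [B B0 hB] := flow_bounded.
have [a a0 ha] := flow_bounded_below.
(* A crude rate, from the lower bound a on the eigenvalues; the sharp one has [ls] in place of a.
   The constant B e^b below makes the barrier equal to B at time 1. *)
pose b := c * ('C(d - 2, k)%:R * a ^+ k).
have C2 : (0 : R) < 'C(d - 2, k)%:R by rewrite ltr0n bin_gt0; clear -kd; lia.
have b_gt0 : 0 < b by rewrite mulr_gt0// mulr_gt0// exprn_gt0.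
have K0 : 0 <= B * expR b by rewrite mulr_ge0 ?expR_ge0// ltW.
exists b => //; exists (B * expR b) => // t i j t1.
wlog h : i j / x 0 j <= x 0 i.
  move=> H; have [/H//|/ltW/H] := leP (x 0 j) (x 0 i).
  by rewrite distrC.
have t0 := le_trans ler01 t1.
have xij : 0 <= x t i - x t j by rewrite subr_ge0; exact: flow_order.
rewrite (ger0_norm xij).
have [->|ij] := eqVneq i j; first by rewrite subrr mulr_ge0 ?expR_ge0.
rewrite -subr_ge0.
apply: (deriv_pos_ge0 (K := 0) (deriv_posB (deriv_posZ (B * expR b)
  (deriv_pos_expRM (- b))) (deriv_pos_flow_diff ij)) ler01 t1).
  rewrite mulr1 -mulrA -expRD subrr expR0 mulr1.
  by have := hB 1 i ler01; have := flow_ge0 j (@ler01 R); lra.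
move=> s s1 _; rewrite mul0r subr_lt0; set y := B * _ * _ => ys.
have := @const_le_esym_flow (~: [set i; j])%SET k s a (ltW a0) (fun i => ha s i (ltW s1)).
rewrite (card_setC2 ij); set e := esym _ _ _ => he.
have y0 : 0 <= y by rewrite mulr_ge0 ?expR_ge0.
have h1 : b * (x s i - x s j) <= c * e * (x s i - x s j).
  by rewrite ler_wpM2r ?(ltW (le_lt_trans y0 ys))// ler_pM2l.
have h2 : b * y <= b * (x s i - x s j) by rewrite ler_pM2l// ltW.
have h3 : B * expR b * (- b * expR (- b * s)) = - (b * y) by rewrite /y; ring.
lra.
Qed.

(** The quotient of cbin (x_m^(k+1) - ls^(k+1)) by x_m - ls, in polynomial form so that it makes
    sense at x_m = ls. *)
Definition rate m t := cbin * \sum_(l < k.+1) x t m ^+ (k - l) * ls ^+ l.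
(** The error made in the equation of x_m when all other eigenvalues are replaced by x_m. *)
Definition defect m t :=
  - c * x t m * (elemsym k (omit m (x t)) - 'C(d.-1, k)%:R * x t m ^+ k).

Lemma deriv_pos_flow_dev m : deriv_pos (fun t => x t m - ls)
  (fun t => - rate m t * (x t m - ls) + defect m t).
Proof.
apply: deriv_pos_ext (deriv_posB (dx m) (deriv_pos_cst ls)) => t _.
have e : rate m t * (x t m - ls) = cbin * x t m ^+ k.+1 - 2 * gamma.
  have e0 : x t m ^+ k.+1 - ls ^+ k.+1 =
      (x t m - ls) * \sum_(l < k.+1) x t m ^+ (k - l) * ls ^+ l.
    by rewrite subrXX; congr (_ * _); apply: eq_bigr => l _; rewrite subSS.
  by rewrite -lsE -mulrBr e0 /rate; ring.
rewrite [RHS](_ : _ = - (rate m t * (x t m - ls)) + defect m t); last by rewrite mulNr.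
by rewrite e /defect /cbin exprS; ring.
Qed.

Lemma rate_ge m t : 0 <= t -> cbin * ls ^+ k <= rate m t.
Proof.
move=> t0; rewrite ler_pM2l ?cbin_gt0// big_ord_recr /= subnn expr0 mul1r lerDr.
by apply: sumr_ge0 => l _; rewrite mulr_ge0 ?exprn_ge0 ?flow_ge0// ltW.
Qed.

Definition after1 : set R := [set t | 1 <= t].
Definition wexp b := fun t : R => expR (- b * t).

Lemma wexp_ge0 b t : after1 t -> 0 <= wexp b t.
Proof. by move=> _; exact: expR_ge0. Qed.

(* [close] also asks for the bounds, which flow_bounded provides. *)
Lemma close_flow b K i j :
  (forall t, 1 <= t -> `|x t i - x t j| <= K * wexp b t) ->
  close (wexp b) after1 (x^~ i) (x^~ j).
Proof.
move=> h; have [B B0 hB] := flow_bounded.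
exists (B + `|K|) => [|t t1]; first by rewrite addr_ge0// ltW.
have t0 := le_trans ler01 t1.
split; [by rewrite ger0_norm ?flow_ge0// ler_wpDr ?hB| by rewrite ger0_norm ?flow_ge0// ler_wpDr ?hB|].
apply: le_trans (h t t1) _; rewrite ler_wpM2r ?wexp_ge0//.
by rewrite (le_trans (ler_norm K))// lerDr ltW.
Qed.

Lemma close_flow_ls b i K : (forall t, 1 <= t -> `|x t i - ls| <= K * wexp b t) ->
  close (wexp b) after1 (x^~ i) (fun=> ls).
Proof.
move=> h; have [B B0 hB] := flow_bounded.
exists (B + ls + `|K|) => [|t t1]; first by rewrite !addr_ge0// ltW.
have t0 := le_trans ler01 t1.
have Bi := hB t i t0; have K0 := normr_ge0 K.
split; [rewrite ger0_norm ?flow_ge0//|rewrite ger0_norm ?(ltW ls_gt0)//|].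
- by have := ls_gt0; lra.
- by have := B0; lra.
apply: le_trans (h t t1) _; rewrite ler_wpM2r ?wexp_ge0//.
by rewrite (le_trans (ler_norm K))// lerDr addr_ge0// ltW.
Qed.

(** The binomial term in [defect] is e_k of the constant list x_m, so closeness of e_k under
    closeness of its arguments applies. *)
Lemma defect_decay b m : (forall i, close (wexp b) after1 (x^~ i) (x^~ m)) ->
  exists2 K, 0 <= K & forall t, 1 <= t -> `|defect m t| <= K * wexp b t.
Proof.
move=> h.
have h1 := close_esym (@wexp_ge0 b) [set~ m]%SET k (y := fun t (_ : 'I_d) => x t m) h.
have h2 := closeM (closeM (close_cst (@wexp_ge0 b) (- c)) (h m)) h1.
have [K K0 hK] := h2; exists K => // t t1; have [_ _] := hK t t1.
by rewrite /defect elemsym_omit -(card_setC1 m) -esym_const mulrBr.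
Qed.

Lemma flow_cvg : exists2 b, 0 < b &
  forall i, close (wexp b) after1 (x^~ i) (fun=> ls).
Proof.
have [b b0 [K K0 hK]] := flow_diff_decay.
have [m _] := flow_min.
have [L L0 hL] := defect_decay (fun i => @close_flow b K i m (fun t ht => hK t i m ht)).
have q0 : 0 < cbin * ls ^+ k by rewrite mulr_gt0 ?cbin_gt0// exprn_gt0.
set q := cbin * ls ^+ k in q0.
(* Staying below q / 2 leaves a gap q - b' of at least q / 2, so that 2 L / q absorbs the
   forcing. *)
pose b' := Num.min b (q / 2).
have b'0 : 0 < b' by rewrite lt_min b0 divr_gt0.
have b'b : b' <= b by rewrite ge_min lexx.
have b'q : b' <= q / 2 by rewrite ge_min lexx orbT.
have we t : 1 <= t -> wexp b t <= wexp b' t.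
  move=> t1; rewrite ler_expR !mulNr lerN2 ler_wpM2r//.
  exact: le_trans ler01 t1.
have [|||||||M M0 hM] := @linear_decay R _ _ _ q b' L (2 * L / q) 1 (deriv_pos_flow_dev m).
- exact: ler01.
- by apply: divr_ge0; [exact: mulr_ge0|exact: ltW].
- by move=> t t1; exact: rate_ge (le_trans ler01 t1).
- move=> t t1; apply: le_trans (hL t t1) _; exact: ler_wpM2l (we t t1).
- exact: ltW.
- lra.
- rewrite -[leLHS](_ : q / 2 * (2 * L / q) = L); last by field; exact: lt0r_neq0.
  apply: ler_wpM2r; last by lra.
  by apply: divr_ge0; [exact: mulr_ge0|exact: ltW].
exists b' => // i; apply: (@close_flow_ls _ _ (K + M)) => t t1.
rewrite mulrDl (_ : x t i - ls = x t i - x t m + (x t m - ls)); last by ring.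
apply: le_trans (ler_normD _ _) _; apply: lerD; last exact: hM.
by apply: le_trans (hK t i m t1) _; exact: ler_wpM2l (we t t1).
Qed.

Lemma rate_cvg m : exists2 b, 0 < b & exists2 K, 0 <= K & forall t, 1 <= t ->
  `|rate m t - cbin * k.+1%:R * ls ^+ k| <= K * expR (- b * t).
Proof.
have [b b0 h] := flow_cvg; exists b => //.
have w0 := @wexp_ge0 b.
have : close (wexp b) after1 (fun t => cbin * \sum_(l < k.+1) x t m ^+ (k - l) * ls ^+ l)
  (fun t => cbin * \sum_(l < k.+1) ls ^+ (k - l) * ls ^+ l).
  apply: closeM => //; first exact: close_cst.
  apply: close_sum => // l _; apply: closeM => //; last exact: close_cst.
  exact: closeX.
move=> [K K0 hK]; exists K => // t t1; have [_ _] := hK t t1.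
rewrite (_ : \sum_(l < k.+1) ls ^+ (k - l) * ls ^+ l = k.+1%:R * ls ^+ k); last first.
  rewrite (eq_bigr (fun=> ls ^+ k)) => [|l _].
    by rewrite sumr_const card_ord mulr_natl.
  by rewrite -exprD subnK// -ltnS.
by rewrite mulrA.
Qed.

(** By [flow_cvg] the coefficient of the difference equation is within an exponentially small error
    of its value at the constant list [ls], so [linear_asymp] gives the sharp rate. *)
Lemma flow_diff_asymp i j : x 0 i != x 0 j -> exists C1 C2, [/\ 0 < C1, 0 < C2 &
  forall t, 1 <= t ->
    C1 * expR (- (c * 'C(d - 2, k)%:R * ls ^+ k) * t) <= `|x t i - x t j|
    <= C2 * expR (- (c * 'C(d - 2, k)%:R * ls ^+ k) * t)].
Proof.
move=> xij; have ij : i != j by apply: contraNneq xij => ->.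
have [b b0 h] := flow_cvg.
have [K K0 hK] := closeM (close_cst (@wexp_ge0 b) c)
  (close_esym (@wexp_ge0 b) (~: [set i; j])%SET k (y := fun t (_ : 'I_d) => ls) h).
apply: (linear_asymp (K := K) (deriv_pos_flow_diff ij) _ b0 K0).
- by rewrite !mulr_ge0 ?exprn_ge0 ?ler0n// ltW.
- move=> t t1; have [_ _] := hK t t1.
  by rewrite esym_const (card_setC2 ij) mulrA.
have [L L0 hL] := esym_flow_bounded (~: [set i; j])%SET 1.
apply: (linear_neq0 (K := c * L) (deriv_pos_flow_diff ij) ler01); last by rewrite subr_eq0.
by move=> t t01; rewrite normrM gtr0_norm// ler_pM2l// hL.
Qed.

Lemma max_dev_ge (y : 'I_d -> R) a i : `|y i - a| <= max_dev a y.
Proof. exact: (le_bigmax _ (fun i => `|y i - a|)). Qed.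

Lemma max_dev_decay b t0 :
  (forall i, exists2 K, 0 <= K & forall t, t0 <= t -> `|x t i - ls| <= K * expR (- b * t)) ->
  exists2 K, 0 <= K & forall t, t0 <= t -> max_dev ls (x t) <= K * expR (- b * t).
Proof.
move=> h; have {}h i : exists K, 0 <= K /\
    forall t, t0 <= t -> `|x t i - ls| <= K * expR (- b * t).
  by have [K K0 hK] := h i; exists K.
have [K hK] := choice h.
have S0 : 0 <= \sum_i K i by apply: sumr_ge0 => i _; have [] := hK i.
exists (\sum_i K i) => // t tt0.
apply: bigmax_le => [|i _]; first by rewrite mulr_ge0 ?expR_ge0.
have [_ /(_ t tt0) hi] := hK i; apply: le_trans hi _; rewrite ler_wpM2r ?expR_ge0//.
by rewrite (bigD1 i)//= lerDl sumr_ge0// => j _; have [] := hK j.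
Qed.

Definition rate_perp := c * 'C(d - 2, k)%:R * ls ^+ k.
Definition rate_par := cbin * k.+1%:R * ls ^+ k.

Lemma rate_perp_gt0 : 0 < rate_perp.
Proof. by rewrite !mulr_gt0 ?exprn_gt0// ltr0n bin_gt0; lia. Qed.

Lemma rate_perp_eq_par : k = 0%N -> rate_perp = rate_par.
Proof. by move=> k0; rewrite /rate_perp /rate_par /cbin k0 !bin0 !mulr1. Qed.

Lemma rate_perp_lt_par : (0 < k)%N -> rate_perp < rate_par.
Proof.
move=> k0; rewrite /rate_perp /rate_par /cbin ltr_pM2r ?exprn_gt0//.
rewrite -mulrA ltr_pM2l// -natrM ltr_nat.
have h : ('C(d - 2, k) <= 'C(d.-1, k))%N by apply: leq_bin2l; clear -kd; lia.
have h1 : (0 < 'C(d.-1, k))%N by rewrite bin_gt0; clear -kd; lia.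
by rewrite (leq_ltn_trans h)// -[X in (X < _)%N]muln1 ltn_pmul2l.
Qed.

Lemma flow_diff_decay_perp i j : exists2 K, 0 <= K &
  forall t, 1 <= t -> `|x t i - x t j| <= K * expR (- rate_perp * t).
Proof.
have [e|/flow_diff_asymp[C1 [C2 [_ C20 h]]]] := eqVneq (x 0 i) (x 0 j); last first.
  by exists C2 => [|t /h/andP[]//]; exact: ltW.
exists 0 => // t t1; have t0 := le_trans ler01 t1.
by rewrite (flow_eq e t0) subrr normr0 mul0r.
Qed.

Lemma flow_dev_decay_perp : exists2 t0, 1 <= t0 & forall i, exists2 K, 0 <= K &
  forall t, t0 <= t -> `|x t i - ls| <= K * expR (- rate_perp * t).
Proof.
have [m _] := flow_min.
have cm i : close (wexp rate_perp) after1 (x^~ i) (x^~ m).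
  by have [K K0 hK] := flow_diff_decay_perp i m; exact: (close_flow hK).
have [L L0 hL] := defect_decay cm.
suff [t0 t01 [M M0 hM]] : exists2 t0, 1 <= t0 & exists2 M, 0 <= M &
    forall t, t0 <= t -> `|x t m - ls| <= M * expR (- rate_perp * t).
  exists t0 => // i; have [K K0 hK] := flow_diff_decay_perp i m.
  exists (K + M) => [|t ht]; first exact: addr_ge0.
  rewrite mulrDl (_ : x t i - ls = x t i - x t m + (x t m - ls)); last by ring.
  apply: le_trans (ler_normD _ _) _; apply: lerD; last exact: hM.
  exact: hK (le_trans t01 ht).
have p0 := rate_perp_gt0.
(* For k = 0 the two rates coincide and leave no gap, but then the defect vanishes and the rate is
   constant. *)
have [k0|k0] := posnP k.
  exists 1 => //; have du := deriv_pos_flow_dev m.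
  have rE t : rate m t = rate_perp.
    rewrite rate_perp_eq_par// /rate /rate_par k0 big_ord1 subn0 !expr0 !mulr1.
    by [].
  have dE t : defect m t = 0.
    by rewrite /defect k0 elemsym_omit esym0 bin0 expr0 mulr1 subrr mulr0.
  apply: (linear_decay (m := rate_perp) (K := 0) (M0 := 0) du) => //.
  - by move=> t _; rewrite rE.
  - by move=> t _; rewrite dE normr0 mul0r.
  - exact: ltW.
  - by rewrite mulr0.
have pp := rate_perp_lt_par k0.
have [b b0 [K K0 hK]] := rate_cvg m.
(* Half the gap: once [rate] is within e of [rate_par], it exceeds [rate_perp] by e, which absorbs a
   forcing decaying at [rate_perp]. *)
pose e := (rate_par - rate_perp) / 2.
have e0 : 0 < e by rewrite divr_gt0// subr_gt0.
have be0 : 0 < b * e by exact: mulr_gt0.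
have tK : 0 <= K / (b * e) by apply: divr_ge0 => //; exact: ltW.
(* From this time on K <= e b t <= e e^(bt), so the error in [rate] is at most e. *)
exists (1 + K / (b * e)); first by rewrite lerDl.
apply: (linear_decay (m := rate_perp + e) (K := L) (M0 := L / e) (deriv_pos_flow_dev m)).
- by rewrite addr_ge0.
- by rewrite divr_ge0// ltW.
- move=> t ht; have t1 : 1 <= t by apply: le_trans ht; rewrite lerDl.
  have := hK t t1; rewrite -/rate_par ler_norml => /andP[h _].
  suff : K * expR (- b * t) <= e by rewrite /e in h *; lra.
  have bt : 0 < b * t by rewrite mulr_gt0// (lt_le_trans ltr01).
  rewrite mulNr expRN -/(_ / _) ler_pdivrMr ?expR_gt0//.
  have h1 : K <= e * (b * t).
    have : K / (b * e) <= t by apply: le_trans ht; rewrite lerDr.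
    rewrite ler_pdivrMr// => /le_trans; apply.
    by rewrite le_eqVlt; apply/orP; left; apply/eqP; ring.
  apply: le_trans h1 _; rewrite ler_pM2l//.
  by have := expR_ge1Dx (b * t); lra.
- by move=> t ht; apply: hL; apply: le_trans ht; rewrite lerDl.
- exact: ltW.
- by rewrite lerDl ltW.
- by rewrite addrAC subrr add0r mulrC divfK// gt_eqF.
Qed.

Lemma max_dev_asymp i j : x 0 i != x 0 j -> exists C1 C2 t0,
  [/\ 0 < C1, 0 < C2, 1 <= t0 & forall t, t0 <= t ->
    C1 * expR (- rate_perp * t) <= max_dev ls (x t) <= C2 * expR (- rate_perp * t)].
Proof.
move=> xij; have [C1 [C2 [C10 _ h]]] := flow_diff_asymp xij.
have [t0 t01 /max_dev_decay[K K0 hK]] := flow_dev_decay_perp.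
(* If two eigenvalues differ by delta, one is at distance at least delta / 2 from [ls]. The summand
   1 ensures positivity. *)
exists (C1 / 2), (K + 1), t0; split=> //; first by rewrite divr_gt0.
  by rewrite ltr_wpDl.
move=> t ht; have /andP[lo _] := h t (le_trans t01 ht).
apply/andP; split; last first.
  by apply: le_trans (hK t ht) _; rewrite ler_wpM2r ?expR_ge0// lerDl.
have hi := max_dev_ge (x t) ls i; have hj := max_dev_ge (x t) ls j.
have : `|x t i - x t j| <= `|x t i - ls| + `|x t j - ls|.
  rewrite (_ : x t i - x t j = (x t i - ls) - (x t j - ls)); last by ring.
  exact: ler_normB.
rewrite -/rate_perp in lo; lra.
Qed.

(** * Constant spectra *)

Section ScalarFlow.
Variable m : 'I_d.
Hypothesis x0_scalar : forall i, x 0 i = x 0 m.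

Lemma flow_scalar i t : 0 <= t -> x t i = x t m.
Proof. by move=> t0; apply: flow_eq. Qed.

Lemma deriv_pos_scalar_dev :
  deriv_pos (fun t => x t m - ls) (fun t => - rate m t * (x t m - ls)).
Proof.
apply: deriv_pos_ext (deriv_pos_flow_dev m) => t t0.
have xE : x t = fun=> x t m by apply/funext => i; rewrite flow_scalar// ltW.
rewrite /defect elemsym_omit [in esym _ _ _]xE esym_const card_setC1 subrr mulr0.
by rewrite addr0.
Qed.

Lemma scalar_dev_asymp : x 0 m != ls -> exists C1 C2, [/\ 0 < C1, 0 < C2 &
  forall t, 1 <= t -> C1 * expR (- rate_par * t) <= `|x t m - ls|
    <= C2 * expR (- rate_par * t)].
Proof.
move=> xls; have [b b0 [K K0 hK]] := rate_cvg m.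
apply: (linear_asymp deriv_pos_scalar_dev _ b0 K0 hK).
  by rewrite !mulr_ge0 ?(ltW cbin_gt0) ?exprn_ge0 ?ler0n// ltW.
have [B B0 hB] := flow_bounded.
apply: (linear_neq0 (K := cbin * \sum_(l < k.+1) B ^+ (k - l) * ls ^+ l)
  deriv_pos_scalar_dev ler01); last by rewrite subr_eq0.
move=> t /andP[t0 _].
have s0 : 0 <= \sum_(l < k.+1) x t m ^+ (k - l) * ls ^+ l.
  by apply: sumr_ge0 => l _; rewrite mulr_ge0 ?exprn_ge0 ?flow_ge0// ltW.
rewrite (ger0_norm (mulr_ge0 (ltW cbin_gt0) s0)).
rewrite ler_pM2l ?cbin_gt0//; apply: ler_sum => l _.
rewrite ler_pM2r ?exprn_gt0//; apply: lerXn2r; rewrite ?nnegrE ?flow_ge0 ?hB//.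
exact: ltW.
Qed.

Lemma scalar_stationary : x 0 m = ls -> forall t i, 0 <= t -> x t i = ls.
Proof.
move=> xls t i t0; rewrite flow_scalar//; apply/eqP; rewrite -subr_eq0 eq_le.
(* As the rate is nonnegative, the deviation can leave 0 neither upwards nor downwards. *)
have q0 s : 0 < s -> 0 <= rate m s.
  move=> s0; apply: le_trans (rate_ge m (ltW s0)).
  by rewrite mulr_ge0 ?exprn_ge0 ?(ltW cbin_gt0)// ltW.
rewrite -oppr_ge0; apply/andP; split.
  apply: (deriv_pos_ge0 (K := 0) (deriv_posN deriv_pos_scalar_dev) (lexx 0) t0).
    by rewrite xls subrr oppr0.
  move=> s s0 _; rewrite oppr_lt0 => us; rewrite mul0r mulNr opprK.
  by rewrite mulr_ge0 ?q0 ?(ltW us).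
apply: (deriv_pos_ge0 (K := 0) deriv_pos_scalar_dev (lexx 0) t0).
  by rewrite xls subrr.
move=> s s0 _ us; rewrite mul0r mulNr -mulrN mulr_ge0 ?q0// oppr_ge0 ltW//.
Qed.

End ScalarFlow.

End EigenFlow.

(** * The covariance flow and the constants of the statement *)

Section Assembly.
Variable R : realType.

(** Each entry is a combination of the v_l with constant coefficients, so the conjugated diagonal
    flow can be differentiated entrywise. *)
Lemma conj_diag_mxE d (P : 'M[R]_d) (v : 'I_d -> R) i j :
  (P^T *m diag_mx (\row_l v l) *m P) i j = \sum_l P l i * P l j * v l.
Proof.
rewrite mul_mx_diag mxE; apply: eq_bigr => l _; rewrite !mxE.
by rewrite mulrAC.
Qed.

Lemma lam_star_gt0 d k (gamma : R) : (k.+1 < d)%N -> 0 < gamma ->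
  0 < lam_star d k.+1 gamma.
Proof.
move=> kd g0; rewrite /lam_star powR_gt0// divr_gt0 ?mulr_gt0 ?ltr0n ?fact_gt0//.
by rewrite bin_gt0; lia.
Qed.

Lemma cn_gt0 n : 0 < cn R n.
Proof. by rewrite divr_gt0 ?ltr0n ?fact_gt0. Qed.

Lemma lam_starE d k (gamma : R) : (k.+1 < d)%N -> 0 < gamma ->
  cbin d k (4 * cn R k.+1) * lam_star d k.+1 gamma ^+ k.+1 = 2 * gamma.
Proof.
move=> kd g0.
have C0 : (0 : R) < 'C(d.-1, k)%:R by rewrite ltr0n bin_gt0; lia.
have f0 : (0 : R) < (k.+1`!)%:R by rewrite ltr0n fact_gt0.
have n0 : (0 : R) < k.+2%:R by rewrite ltr0n.
rewrite /lam_star -powR_mulrn ?powR_ge0// -powRrM mulVf ?pnatr_eq0// powRr1; last first.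
  by rewrite divr_ge0 ?mulr_ge0// ltW.
rewrite /cbin /cn !subn1 /=; field.
by rewrite !gt_eqF.
Qed.

Lemma max_dev_const d (m : 'I_d) (a b : R) (y : 'I_d -> R) :
  (forall i, y i = b) -> max_dev a y = `|b - a|.
Proof.
move=> yb; apply/le_anti/andP; split; last by rewrite -(yb m) max_dev_ge.
by apply: bigmax_le => // i _; rewrite yb.
Qed.

Lemma eigen_flow_deriv_pos d n (gamma : R) lam0 (lam : R -> 'I_d -> R) :
  eigen_flow n gamma lam0 lam -> forall i,
  deriv_pos (fun t => lam (Num.max 0 t) i) (fun t => - (4 * cn R n) *
    lam (Num.max 0 t) i * elemsym n.-1 (omit i (lam (Num.max 0 t))) + 2 * gamma).
Proof.
move=> [_ h] i; have := has_deriv_ge0_deriv_pos (fun t t0 => h t t0 i).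
by apply: deriv_pos_ext => t t0; rewrite (max_idPr (ltW t0)) mulNr.
Qed.

Lemma cov_flow_conj d n (gamma : R) (Sigma0 : 'M[R]_d) lam0 (lam : R -> 'I_d -> R)
    (Sigma : R -> 'M[R]_d) (P : 'M[R]_d) :
  (n.-1 <= d)%N -> eigen_flow n gamma lam0 lam -> cov_flow n gamma Sigma0 Sigma ->
  P^T *m P = 1%:M -> Sigma0 = P^T *m diag_mx (\row_i lam0 i) *m P ->
  forall t, 0 <= t -> Sigma t = P^T *m diag_mx (\row_i lam t i) *m P.
Proof.
move=> nd hlam hSigma PP S0 b b0.
pose F (A : 'M[R]_d) := - (4 * cn R n) *: (A *m Tmx n.-1 A) + (2 * gamma)%:M.
pose x t := lam (Num.max 0 t).
pose N t := P^T *m diag_mx (\row_i x t i) *m P.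
suff : Sigma (Num.max 0 b) = N b by rewrite /N /x (max_idPr b0).
apply: (@matrix_flow_unique R d F (fun t => Sigma (Num.max 0 t)) N) b b0.
- move=> w D w0 h i j; rewrite /F.
  apply: (@close_ext _ _ _ _ (fun t => - (4 * cn R n) *
      (Sigma (Num.max 0 t) *m Tmx n.-1 (Sigma (Num.max 0 t))) i j + (2 * gamma)%:M i j) _
    (fun t => - (4 * cn R n) * (N t *m Tmx n.-1 (N t)) i j + (2 * gamma)%:M i j)).
  + by move=> t _; rewrite !mxE.
  + by move=> t _; rewrite !mxE.
  apply: closeD; last exact: close_cst.
  apply: closeM; first exact: close_cst.
  by apply: close_mulmx => // i' j'; exact: Tmx_close.
- move=> i j; case: hSigma => _ h.
  have := has_deriv_ge0_deriv_pos (fun t t0 => h t t0 i j).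
  by apply: deriv_pos_ext => t t0; rewrite (max_idPr (ltW t0)).
(* F commutes with orthogonal conjugation, and on a diagonal matrix it acts as the right-hand side
   of the eigenvalue equations. *)
- move=> i j; have FN t : F (N t) = P^T *m diag_mx (\row_l (- (4 * cn R n) *
      x t l * elemsym n.-1 (omit l (x t)) + 2 * gamma)) *m P.
    have -> : diag_mx (\row_l (- (4 * cn R n) * x t l * elemsym n.-1 (omit l (x t))
        + 2 * gamma)) = - (4 * cn R n) *: (diag_mx (\row_l x t l) *m
        Tmx n.-1 (diag_mx (\row_l x t l))) + (2 * gamma)%:M.
      rewrite Tmx_diag// mulmx_diag; apply/matrixP => a b; rewrite !mxE.
      by case: eqP => _; [rewrite !mulr1n; ring|rewrite !mulr0n mulr0 addr0].
    rewrite mulmxDr mulmxDl -scalemxAr -scalemxAl mul_mx_scalar -scalemxAl PP scalemx1.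
    rewrite /F /N Tmx_conj//; congr (_ *: _ + _).
    by rewrite !mulmxA -[_ *m P *m P^T]mulmxA (mulmx1C PP) mulmx1.
  rewrite (_ : (fun t => N t i j) = fun t => \sum_l P l i * P l j * x t l); last first.
    by apply/funext => t; rewrite /N conj_diag_mxE.
  apply: (@deriv_pos_ext _ _ (fun t => \sum_l P l i * P l j * (- (4 * cn R n) *
      x t l * elemsym n.-1 (omit l (x t)) + 2 * gamma))).
    by move=> t _; rewrite FN conj_diag_mxE.
  apply: (deriv_pos_sum _ _ (F := fun l t => P l i * P l j * x t l)) => l.
  exact/deriv_posZ/(eigen_flow_deriv_pos hlam).
- by rewrite /N /x maxxx; case: hSigma => -> _; case: hlam => -> _.
Qed.

End Assembly.

Theorem corollary5p1 (R : realType) (d n : nat) (hn : (1 <= n)%N) (hnd : (n < d)%N)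
    (gamma : R) (hgamma : 0 < gamma)
    (Sigma0 : 'M[R]_d) (hSigma0 : symmetric_psd Sigma0)
    (lam0 : 'I_d -> R)
    (hspec : char_poly Sigma0 = \prod_(i < d) ('X - (lam0 i)%:P))
    (hsort : forall i j : 'I_d, (i <= j)%N -> lam0 j <= lam0 i)
    (hlam0 : forall i : 'I_d, 0 <= lam0 i)
    (lam : R -> 'I_d -> R) (hlam : eigen_flow n gamma lam0 lam)
    (Sigma : R -> 'M[R]_d) (hSigma : cov_flow n gamma Sigma0 Sigma) :
  let ls := lam_star d n gamma in
  let ap := alpha_perp d n gamma in
  let al := alpha_par d n gamma in
  (forall P : 'M[R]_d, P^T *m P = 1%:M ->
     Sigma0 = P^T *m diag_mx (\row_i lam0 i) *m P ->
     forall t : R, 0 <= t -> Sigma t = P^T *m diag_mx (\row_i lam t i) *m P) /\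
  al = 2 * n%:R * gamma / ls /\
  (forall i j : 'I_d, lam0 i <> lam0 j ->
     asymp_equiv (fun t => `|lam t i - lam t j|) (fun t => expR (- ap * t)) /\
     (t^-1 * ln `|lam t i - lam t j| @[t --> +oo] --> - ap)) /\
  (~ (exists a : R, Sigma0 = a *: 1%:M) ->
     asymp_equiv (fun t => max_dev ls (lam t)) (fun t => expR (- ap * t)) /\
     (t^-1 * ln (max_dev ls (lam t)) @[t --> +oo] --> - ap)) /\
  (forall s0 : R, 0 <= s0 -> s0 <> ls -> Sigma0 = s0 *: 1%:M ->
     exists s : R -> R,
       [/\ forall t : R, 0 <= t -> forall i : 'I_d, lam t i = s t,
           forall t : R, 0 <= t -> max_dev ls (lam t) = `|s t - ls| &
           asymp_equiv (fun t => `|s t - ls|) (fun t => expR (- al * t))]) /\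
  (Sigma0 = ls *: 1%:M -> forall t : R, 0 <= t -> Sigma t = Sigma0) /\
  (ap <= al /\ (n = 1%N -> al = ap)).
Proof.
case: n hn hnd hlam hSigma => // k _ kd hlam hSigma ls ap al.
pose x t := lam (Num.max 0 t).
pose c := 4 * cn R k.+1.
have c0 : 0 < c by rewrite mulr_gt0// cn_gt0.
have ls0 : 0 < ls by exact: lam_star_gt0.
have lsE : cbin d k c * ls ^+ k.+1 = 2 * gamma by exact: lam_starE.
have dx i : deriv_pos (x^~ i)
    (fun t => - c * x t i * elemsym k (omit i (x t)) + 2 * gamma).
  exact: eigen_flow_deriv_pos hlam i.
have xE t : 0 <= t -> x t = lam t by move=> t0; rewrite /x (max_idPr t0).
have x0E : x 0 = lam0 by rewrite xE//; case: hlam.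
have x00 i : 0 <= x 0 i by rewrite x0E.
have apE : ap = rate_perp d k c ls by rewrite /ap /alpha_perp subn1.
have alE : al = rate_par d k c ls.
  rewrite /al /alpha_par /rate_par /cbin /c /ls !subn1 /=; ring.
have kd1 : (k.+1.-1 <= d)%N by exact: ltnW (ltnW kd).
have m : 'I_d by exists 0%N; exact: ltn_trans kd.
have scalarE a : Sigma0 = a *: 1%:M -> forall i, lam0 i = a.
  by move=> e; apply: char_poly_scalar_eq; rewrite -e.
split; first by move=> P PP S0; exact: (cov_flow_conj kd1 hlam hSigma).
split.
  have lsn0 : ls != 0 by rewrite gt_eqF.
  (* Multiplied by [ls], the claim is n times the equilibrium equation [lsE]. *)
  apply: (mulIf lsn0); rewrite divfK// alE /rate_par.
  rewrite [LHS](_ : _ = k.+1%:R * (cbin d k c * ls ^+ k.+1)); last by rewrite exprS; ring.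
  by rewrite lsE; ring.
split.
  move=> i j /eqP; rewrite -x0E => xij.
  have [C1 [C2 [C10 C20 h]]] := flow_diff_asymp kd c0 hgamma dx x00 ls0 lsE xij.
  have e : asymp_equiv (fun t => `|lam t i - lam t j|) (fun t => expR (- ap * t)).
    exists C1, C2, 1; split=> // t t1; have := h t t1.
    by rewrite xE ?(le_trans ler01)// -/(rate_perp d k c ls) -apE => /andP.
  by split=> //; exact: asymp_equiv_expR_lnv.
split.
  (* If all initial eigenvalues were equal, the symmetric matrix [Sigma0] would be scalar. *)
  move=> ns; have [i xi] : exists i, lam0 i != lam0 m.
    apply: contrapT => h; apply: ns; exists (lam0 m).
    apply: sym_char_poly_scalar; first by case: hSigma0.
    rewrite hspec; apply: eq_bigr => i _; congr ('X - _%:P).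
    by apply/eqP; apply: contrapT => /negP hi; apply: h; exists i.
  rewrite -x0E in xi.
  have [C1 [C2 [t0 [C10 C20 t01 h]]]] := max_dev_asymp kd c0 hgamma dx x00 ls0 lsE xi.
  have e : asymp_equiv (fun t => max_dev ls (lam t)) (fun t => expR (- ap * t)).
    exists C1, C2, t0; split=> //; first exact: lt_le_trans t01.
    move=> t tt0; have := h t tt0.
    by rewrite xE ?(le_trans ler01) ?(le_trans t01)// -apE => /andP.
  by split=> //; exact: asymp_equiv_expR_lnv.
split.
  move=> s0 s00 s0ls /scalarE s0E; exists (fun t => lam t m).
  have xs i : x 0 i = x 0 m by rewrite x0E !s0E.
  have ls_eq t i : 0 <= t -> lam t i = lam t m.
    by move=> t0; rewrite -xE//; exact: (flow_scalar c0 dx xs).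
  split; [by move=> t t0 i; exact: ls_eq| |].
    by move=> t t0; apply: (max_dev_const m) => i; exact: ls_eq.
  have xls : x 0 m != ls by rewrite x0E s0E; exact/eqP.
  have [C1 [C2 [C10 C20 h]]] := scalar_dev_asymp kd c0 hgamma dx x00 ls0 lsE xs xls.
  exists C1, C2, 1; split=> // t t1; have := h t t1.
  by rewrite xE ?(le_trans ler01)// -alE => /andP.
split.
  move=> S0; have s0E := scalarE _ S0; move=> t t0.
  have xs i : x 0 i = x 0 m by rewrite x0E !s0E.
  have xm : x 0 m = ls by rewrite x0E s0E.
  (* A scalar matrix is diagonalized by the identity, so the conjugation formula applies with P =
     1. *)
  have diagE (y : 'I_d -> R) : (forall i, y i = ls) ->
      Sigma0 = 1%:M^T *m diag_mx (\row_i y i) *m 1%:M.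
    move=> ye; rewrite trmx1 mul1mx mulmx1 S0 scalemx1; apply/matrixP => i j.
    by rewrite !mxE ye.
  rewrite (cov_flow_conj kd1 hlam hSigma _ (diagE _ s0E) t0); last first.
    by rewrite trmx1 mul1mx.
  rewrite -diagE// => i; rewrite -xE//.
  exact: (scalar_stationary kd c0 hgamma dx x00 ls0 lsE xs xm).
rewrite apE alE; split; last first.
  by move=> [k0]; rewrite rate_perp_eq_par.
have [k0|k0] := posnP k; first by rewrite rate_perp_eq_par.
exact: ltW (rate_perp_lt_par kd c0 ls0 k0).
Qed.
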